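(* Let $M$ be a connected paving matroid of rank $r$ on $[n]$ whose set of hyperplanes is $\mathcal{H}$, and for $r\le s\le n$ let $\mathcal{H}_s=\{H\in\mathcal{H}:|H|=s\}$. Then \[ \mathrm{Vol}(\mathcal{P}_M)=A(n-1,r-1)-\sum_{s=r}^{n}|\mathcal{H}_s|\sum_{\substack{T\subseteq[n-s,n-2]\\|T|=r-1}}\beta_n(T). \]
   Context: A rank-$r$ matroid is paving if every circuit has at least $r$ elements; a hyperplane is a flat of rank $r-1$. $\mathcal{P}_M=\mathrm{conv}\{\sum_{i\in B}\mathbf{e}_i: B\text{ a basis}\}$. $A(n-1,r-1)$ is the Eulerian number: the number of permutations of $[n-1]$ with exactly $r-1$ descents. $[a,b]=\{a,\dots,b\}$. For $w\in\mathfrak{S}_{n-1}$, $\mathrm{Des}(w)=\{i\in[n-2]:w_i>w_{i+1}\}$, and $\beta_n(T)=|\{w\in\mathfrak{S}_{n-1}:\mathrm{Des}(w)=T\}|$. $\mathrm{Vol}$ is the normalized volume: $d!$ times the volume with respect to the lattice $\mathbb{Z}^n\cap(\text{affine hull})$, $d$ the dimension (a unimodular simplex has volume 1). *)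

(* Defs.v *)
From mathcomp Require Import all_boot all_order all_algebra all_fingroup.
From mathcomp Require Import all_classical all_reals all_analysis.

Set Implicit Arguments.
Unset Strict Implicit.
Unset Printing Implicit Defensive.

Import Order.TTheory GRing.Theory Num.Theory.
Local Open Scope ring_scope.

(* Matroids on a finite ground set, presented by their bases. The set [n] is
   represented by 'I_n, the element i of [n] being the ordinal i - 1. *)

Record matroid (E : finType) := Matroid {
  bases : {set {set E}};
  bases_nonempty : bases != finset.set0;
  basis_exchange : forall A B : {set E}, A \in bases -> B \in bases ->
    forall x : E, x \in A :\: B ->
    exists2 y : E, y \in B :\: A & y |: (A :\ x) \in bases
}.

Section Matroid.
Context (E : finType) (M : matroid E).
Implicit Types (A I C F H : {set E}).

Definition indep I : bool := [exists B in bases M, I \subset B].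

Definition circuit C : bool := minset (fun A => ~~ indep A) C.

Definition rank A : nat := \max_(I in powerset A | indep I) #|I|.

Definition matroid_rank : nat := rank [set: E].

Definition flat F : bool :=
  [forall x, (x \notin F) ==> (rank F < rank (x |: F))%N].

(* Written with a successor so that a matroid of rank 0 has no hyperplane. *)
Definition hyperplane H : bool := flat H && ((rank H).+1 == matroid_rank).

Definition hyperplanes_of_size (s : nat) : {set {set E}} :=
  [set H : {set E} | hyperplane H && (#|H| == s)].

Definition paving : Prop :=
  forall C, circuit C -> (matroid_rank <= #|C|)%N.

Definition matroid_connected : Prop :=
  forall x y : E, x != y -> exists C, [/\ circuit C, x \in C & y \in C].

End Matroid.

(* One-line notation with positions and values both starting at 1: for
   1 <= i <= m this is the i-th letter, in [m], of w. *)
Definition letter (m : nat) (w : 'S_m) (i : nat) : nat :=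
  nth 0%N [seq (val (w j)).+1 | j <- enum 'I_m] i.-1.

(* Positions are kept literally: the descent set, a subset of {1, ..., m - 1},
   lives in {set 'I_m} because 'I_m is {0, ..., m - 1}. *)
Definition Des (m : nat) (w : 'S_m) : {set 'I_m} :=
  [set i : 'I_m | (0 < i)%N && (letter w i.+1 < letter w i)%N].

Definition eulerian (m k : nat) : nat := #|[set w : 'S_m | #|Des w| == k]|.

Definition beta (n : nat) (T : {set 'I_n.-1}) : nat :=
  #|[set w : 'S_n.-1 | Des w == T]|.

(* The integers of [a, b] among 0, ..., m - 1. *)
Definition int_interval (m a b : nat) : {set 'I_m} :=
  [set i : 'I_m | (a <= i <= b)%N].

Section Volume.
Context (R : realType).
Local Open Scope classical_set_scope.

Definition affine_hull n (S : set 'rV[R]_n) : set 'rV[R]_n :=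
  [set x | exists (k : nat) (v : 'I_k -> 'rV[R]_n) (a : 'I_k -> R),
    [/\ forall i, S (v i), \sum_i a i = 1 & x = \sum_i a i *: v i]].

Definition convex_hull n (S : set 'rV[R]_n) : set 'rV[R]_n :=
  [set x | exists (k : nat) (v : 'I_k -> 'rV[R]_n) (a : 'I_k -> R),
    [/\ forall i, S (v i), forall i, 0 <= a i, \sum_i a i = 1
      & x = \sum_i a i *: v i]].

Definition integer_points n : set 'rV[R]_n :=
  [set x | forall i, x 0 i \is a Num.int].

(* Lebesgue measure on R^d: the library's product measure, iterated and
   transported along (x, t) |-> x :: t. *)
Fixpoint lebesgue_tuple (d : nat) : set (d.-tuple (measurableTypeR R)) -> \bar R :=
  match d with
  | 0 => \d_[tuple]
  | d'.+1 =>
    pushforward (@lebesgue_measure R \x @lebesgue_tuple d')%E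
      (fun p : measurableTypeR R * d'.-tuple (measurableTypeR R) =>
         [tuple of p.1 :: p.2])
  end.

Definition lebesgue_row (d : nat) (A : set 'rV[R]_d) : \bar R :=
  lebesgue_tuple [set t : d.-tuple R | A (\row_i tnth t i)].

(* Affine coordinates x |-> p + x B from R^d. *)
Definition frame (n : nat) : Type := {d : nat & ('rV[R]_n * 'M[R]_(d, n))%type}.
Definition frame_dim n (c : frame n) : nat := tag c.

Definition frame_map n (c : frame n) (x : 'rV[R]_(frame_dim c)) : 'rV[R]_n :=
  (tagged c).1 + x *m (tagged c).2.

(* c parametrizes the affine subspace L bijectively, and in such a way that
   Z^d corresponds to the lattice of integer points of L. *)
Definition lattice_frame n (L : set 'rV[R]_n) (c : frame n) : Prop :=
  [/\ injective (frame_map (c := c)),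
      range (frame_map (c := c)) = L
    & frame_map (c := c) @` @integer_points _ = @integer_points n `&` L].

(* Any two lattice frames of L differ by an affine unimodular transformation
   of R^d, so the choice made by xget is immaterial; a lattice frame exists as
   soon as the affine hull of P is that of a nonempty set of integer points. *)
Definition normalized_volume n (P : set 'rV[R]_n) : \bar R :=
  let c := xget (existT _ 0%N (0, 0) : frame n)
             [set c | lattice_frame (affine_hull P) c] in
  ((frame_dim c)`!%:R%:E * lebesgue_row (frame_map (c := c) @^-1` P))%E.

Definition indicator_row n (B : {set 'I_n}) : 'rV[R]_n :=
  \sum_(i in B) delta_mx 0 i.

Definition base_polytope n (M : matroid 'I_n) : set 'rV[R]_n :=
  convex_hull [set indicator_row B | B in [set` bases M]].

End Volume.

Arguments base_polytope R {n} M.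

(* Main.v *)
(* Every point x of the hypersimplex {0 <= x <= 1, sum x = r} that violates
   x(H) <= r - 1 for some hyperplane H of the paving matroid does so for only
   one of them, because two hyperplanes meet in at most r - 2 elements. Moreover
   these inequalities cut out the base polytope: at a point with a fractional
   coordinate, some e_i - e_j is a direction along which all tight constraints
   stay tight, so the vertices are integral, and an integral point is a basis
   unless it lies in a hyperplane. Hence the base polytope is the hypersimplex
   minus disjoint pieces {x(H) > r - 1}.

   After permuting coordinates so that H is the set of the last s ones and
   forgetting the last coordinate, the piece becomes
     {x in [0,1]^(n-1) | r - 1 <= sum x <= r, x_1 + ... + x_(n-s) < 1}.
   Stanley's piecewise unimodular map, which sends x to the fractional parts of
   its partial sums, turns it into the set of the y in the cube with r - 1
   descents, all in [n - s, n - 2]; and the y whose entries are ordered as a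
   given permutation have volume 1/(n-1)!. With the constraint on
   x_1 + ... + x_(n-s) dropped, this gives the hypersimplex itself. *)

(* Connectedness fixes the dimension: a circuit through i and j yields two bases that differ by
   exchanging i and j, so every e_i - e_j is a difference of two vertices and the affine hull is the
   whole slice sum x = r. The frame in [normalized_volume] is an arbitrary choice; two lattice
   frames differ by an integral matrix with integral inverse, so the change of variables for affine
   maps makes every frame as good as the one that forgets the last coordinate. The same independence
   permits permuting all n coordinates, the forgotten one included; for the last s of them, x(H) > r
   - 1 becomes a bound on the partial sum of the first n - s. Hyperplanes with fewer than r elements
   cut off nothing, whence the start s = r of the sum. Descents are counted exactly on half-open
   cells, whereas the polytope is closed, so ties, coordinates equal to 1 and extreme sums have to
   be shown null. *)
Require Import Defs.
From HB Require Import structures.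
From mathcomp Require Import all_boot all_order all_algebra all_fingroup.
From mathcomp Require Import zify.

Set Implicit Arguments.
Unset Strict Implicit.
Unset Printing Implicit Defensive.

(** * Bases and hyperplanes of paving matroids *)

Section Bases.
Context (E : finType) (M : matroid E).
Implicit Types (A B I J C F H : {set E}) (x y z : E).

Lemma exchange_card A x y : x \in A -> y \notin A -> #|y |: (A :\ x)| = #|A|.
Proof.
by move=> xA yA; rewrite cardsU1 !inE negb_and negbK (negbTE yA) orbT (cardsD1 x A) xA.
Qed.

(** Exchanging an element of [A' :\: B'] for one of [B' :\: A'] keeps the size of [A'] and shrinks
    the difference, until [A'] lies inside [B']. *)
Lemma basis_card A B : A \in bases M -> B \in bases M -> #|A| = #|B|.
Proof.
suff le A' B' : A' \in bases M -> B' \in bases M -> (#|A'| <= #|B'|)%N.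
  by move=> bA bB; apply/eqP; rewrite eqn_leq !le.
have [k] := ubnP #|A' :\: B'|.
elim: k A' => // k IH A' Ak bA bB.
have [AB|[x xAB]] := set_0Vmem (A' :\: B').
  by apply: subset_leq_card; rewrite -setD_eq0 AB.
have [y yBA bA'] := basis_exchange bA bB xAB.
move: (xAB) (yBA); rewrite !inE => /andP[xB xA] /andP[yA yB].
rewrite -(exchange_card xA yA); apply: IH => //.
apply: leq_trans (ltnSE Ak); apply: proper_card; apply/properP; split.
  apply/subsetP => z; rewrite !inE => /andP[zB /orP[/eqP zy|/andP[_ ->]]];
    last by rewrite zB.
  by rewrite zy yB in zB.
exists x => //; rewrite !inE eqxx/= orbF negb_and negbK (negbTE xB)/=.
by apply: contraNneq yA => <-.
Qed.

Lemma basisP : exists B, B \in bases M.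
Proof. exact/set0Pn/bases_nonempty. Qed.

Lemma indepP I : reflect (exists2 B, B \in bases M & I \subset B) (indep M I).
Proof. exact: exists_inP. Qed.

Lemma indepS I J : I \subset J -> indep M J -> indep M I.
Proof.
by move=> IJ /indepP[B bB JB]; apply/indepP; exists B => //; exact: subset_trans JB.
Qed.

Lemma basis_indep B : B \in bases M -> indep M B.
Proof. by move=> bB; apply/indepP; exists B. Qed.

Lemma rank_ge A I : I \subset A -> indep M I -> (#|I| <= rank M A)%N.
Proof.
by move=> IA iI; apply: (@leq_bigmax_cond _ _ (fun J => #|J|)); rewrite inE IA.
Qed.

Lemma rank_witness A : exists I, [/\ I \subset A, indep M I & #|I| = rank M A].
Proof.
have [B bB] := basisP.
have [|I] := @eq_bigmax_cond _ [pred I | (I \in powerset A) && indep M I] (fun J => #|J|).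
  apply/card_gt0P; exists set0; rewrite !inE sub0set.
  by apply/indepP; exists B; rewrite ?sub0set.
by rewrite !inE => /andP[IA iI] rE; exists I.
Qed.

Lemma basis_rank B : B \in bases M -> #|B| = matroid_rank M.
Proof.
move=> bB; apply/eqP; rewrite eqn_leq rank_ge ?subsetT ?basis_indep//=.
rewrite /matroid_rank; have [I [_ /indepP[B' bB' IB'] <-]] := rank_witness [set: E].
by rewrite (basis_card bB bB') subset_leq_card.
Qed.

Lemma indep_card I : indep M I -> (#|I| <= matroid_rank M)%N.
Proof. by move=> iI; apply: rank_ge; rewrite ?subsetT. Qed.

Lemma indep_basis I : indep M I -> #|I| = matroid_rank M -> I \in bases M.
Proof.
move=> /indepP[B bB IB] cI; suff -> : I = B by [].
by apply/eqP; rewrite eqEcard IB (basis_rank bB) cI leqnn.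
Qed.

(** A basis containing I has a single further element a. If a is not already in B, basis exchange
    replaces it by an element of B. *)
Lemma indep_augment I B : indep M I -> #|I|.+1 = matroid_rank M -> B \in bases M ->
  exists2 y, y \in B :\: I & y |: I \in bases M.
Proof.
move=> /indepP[A bA IA] cI bB.
have /cards1P[a AI] : #|A :\: I| == 1%N.
  by rewrite cardsDS// (basis_rank bA) -cI subSnn.
have aA : a \in A :\: I by rewrite AI inE.
have IE : A :\ a = I by rewrite -AI setDDr setDv set0U; apply/setIidPr.
have AE : a |: I = A by rewrite -IE setD1K//; move: aA; rewrite inE => /andP[].
move: (aA); rewrite inE => /andP[aI aA'].
have [aB|aB] := boolP (a \in B).
  by exists a; rewrite ?inE ?aI// AE.
have [|y] := basis_exchange bA bB (x := a); first by rewrite inE aB aA'.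
rewrite IE => yBA bI; exists y => //.
by move: yBA; rewrite !inE => /andP[yA ->]; rewrite (contra _ yA)//; apply/subsetP.
Qed.

(* The closure of I, provided that I is independent of size r - 1. *)
Definition span I : {set E} := [set x | x |: I \notin bases M].

Lemma subset_span I : #|I|.+1 = matroid_rank M -> I \subset span I.
Proof.
move=> cI; apply/subsetP => x xI; rewrite inE (setUidPr _) ?sub1set//.
by apply/negP => /basis_rank; lia.
Qed.

Lemma rank_span I : indep M I -> #|I|.+1 = matroid_rank M -> (rank M (span I)).+1 =
  matroid_rank M.
Proof.
move=> iI cI; apply/eqP; rewrite eqn_leq -{2}cI ltnS rank_ge ?subset_span// andbT.
have [J [Jsub iJ <-]] := rank_witness (span I).
rewrite ltn_neqAle (indep_card iJ) andbT; apply/eqP => /(indep_basis iJ) bJ.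
have [y] := indep_augment iI cI bJ; rewrite inE => /andP[_ /(subsetP Jsub)].
by rewrite inE => /negP.
Qed.

Lemma hyperplane_span I : indep M I -> #|I|.+1 = matroid_rank M -> hyperplane M (span I).
Proof.
move=> iI cI; rewrite /hyperplane rank_span// eqxx andbT.
apply/forallP => x; apply/implyP; rewrite inE negbK => bxI.
rewrite -ltnS rank_span// ltnS -(basis_rank bxI); apply: rank_ge.
  exact/setUS/subset_span.
exact: basis_indep.
Qed.

(** H contains no basis, so its points cannot extend I to one. A point x outside H raises the rank
    to r, and augmenting I from a basis inside [x |: H] can only add x. *)
Lemma hyperplane_unique H I : hyperplane M H -> I \subset H -> indep M I ->
  #|I|.+1 = matroid_rank M -> H = span I.
Proof.
move=> /andP[/forallP fH /eqP rH] IH iI cI.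
have noB B : B \in bases M -> ~~ (B \subset H).
  move=> bB; apply/negP => BH; have := rank_ge BH (basis_indep bB).
  by rewrite (basis_rank bB); lia.
apply/eqP; rewrite eqEsubset; apply/andP; split; apply/subsetP => x.
  move=> xH; rewrite inE; apply/negP => /noB/negP; apply.
  by apply/subsetP => y; rewrite !inE => /orP[/eqP->//|/(subsetP IH)].
rewrite inE => xI; apply: contraR xI => xH.
have := fH x; rewrite xH/= => rx.
have [J [Jsub iJ cJ]] := rank_witness (x |: H).
have bJ : J \in bases M.
  by apply: indep_basis => //; have := indep_card iJ; lia.
have [y] := indep_augment iI cI bJ; rewrite inE => /andP[_ /(subsetP Jsub)].
rewrite !inE => /orP[/eqP ->//|yH] /noB/negP[].
by apply/subsetP => z; rewrite !inE => /orP[/eqP->//|/(subsetP IH)].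
Qed.

Lemma basis_hyperplane B H : B \in bases M -> hyperplane M H ->
  (#|B :&: H| < matroid_rank M)%N.
Proof.
move=> bB /andP[_ /eqP <-]; rewrite ltnS; apply: rank_ge; first exact: subsetIr.
exact/(indepS (subsetIl _ _))/basis_indep.
Qed.

Lemma subset_of_card A k : (k <= #|A|)%N -> exists2 I : {set E}, I \subset A & #|I| = k.
Proof.
move=> kA; exists [set x in take k (enum A)].
  by apply/subsetP => x; rewrite inE => /mem_take; rewrite mem_enum.
rewrite cardsE; have /card_uniqP -> :
  uniq (take k (enum A)) by rewrite take_uniq ?enum_uniq.
by rewrite size_take -cardE; case: ltngtP kA.
Qed.

Lemma circuit_dep C : circuit M C -> ~~ indep M C.
Proof. by move/minsetp. Qed.

Lemma circuit_indep C x : circuit M C -> x \in C -> indep M (C :\ x).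
Proof.
move=> /minsetP[_ mC] xC; apply: contraT => nI.
have /setP/(_ x) := mC _ nI (subsetDl _ _).
by rewrite !inE eqxx xC.
Qed.

Hypothesis pavingM : paving M.

Lemma paving_indep A : (#|A| < matroid_rank M)%N -> indep M A.
Proof.
move=> Ar; apply: contraT => /(minset_exists (P := fun A => ~~ indep M A))[C cC CA].
by have := pavingM cC; have := subset_leq_card CA; lia.
Qed.

(** A common subset of size r - 1 would be independent by paving, and both hyperplanes would be its
    closure. *)
Lemma hyperplane_meet H H' : hyperplane M H -> hyperplane M H' -> H != H' ->
  (#|H :&: H'|.+1 < matroid_rank M)%N.
Proof.
move=> hH hH'; rewrite ltnNge; apply: contra => rI.
have r0 : (0 < matroid_rank M)%N by case/andP: hH => _ /eqP <-.
have [|I IH cI] := @subset_of_card (H :&: H') (matroid_rank M).-1; first lia.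
move: IH; rewrite subsetI => /andP[IH IH'].
have iI : indep M I by apply: paving_indep; lia.
have cI' : #|I|.+1 = matroid_rank M by lia.
by rewrite (hyperplane_unique hH IH iI cI') (hyperplane_unique hH' IH' iI cI').
Qed.

Lemma nonbasis_hyperplane B : #|B| = matroid_rank M -> B \notin bases M ->
  exists2 H, hyperplane M H & B \subset H.
Proof.
move=> cB nB.
have [B0|[b bB]] := set_0Vmem B.
  have [A bA] := basisP; have := basis_rank bA; rewrite -cB B0 cards0 => /cards0_eq A0.
  by rewrite B0 -A0 bA in nB.
have cI : #|B :\ b|.+1 = matroid_rank M by rewrite -cB (cardsD1 b B) bB.
have iI : indep M (B :\ b) by apply: paving_indep; lia.
exists (span (B :\ b)); first exact: hyperplane_span.
apply/subsetP => x xB; have [->|xb] := eqVneq x b; first by rewrite inE setD1K.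
by apply: (subsetP (subset_span cI)); rewrite !inE xb.
Qed.

Hypothesis connectedM : matroid_connected M.

(** This realizes e_x - e_y as a difference of two vertices of the base polytope, which determines
    its affine hull. *)
Lemma connected_exchange x y : x != y -> exists B,
  [/\ B \in bases M, x \notin B, y \in B & x |: (B :\ y) \in bases M].
Proof.
move=> xy; have [C [cC xC yC]] := connectedM xy.
have iCx := circuit_indep cC xC; have iCy := circuit_indep cC yC.
have rC := pavingM cC.
have cx : #|C :\ x|.+1 = #|C| by rewrite (cardsD1 x C) xC.
have cy : #|C :\ y|.+1 = #|C| by rewrite (cardsD1 y C) yC.
(* A circuit of a paving matroid has r or r + 1 elements. With r + 1, deleting x or y from it
   already gives the two bases; with r, both deletions are completed by the same element z. *)
have [Cr|Cr] := eqVneq #|C| (matroid_rank M); last first.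
  have bx : C :\ x \in bases M by apply: indep_basis => //; have := indep_card iCx; lia.
  exists (C :\ x); split; rewrite ?inE ?eqxx// 1?eq_sym ?xy ?yC//.
  have -> : x |: (C :\ x :\ y) = C :\ y; last by apply: indep_basis => //; have :=
    indep_card iCx; lia.
  by apply/setP => z; rewrite !inE; have [->|] := eqVneq z x; rewrite ?xC ?xy.
have /indepP[B bB CB] := iCx.
have xB : x \notin B.
  apply: contra (circuit_dep cC) => xB; apply/indepP; exists B => //.
  by apply/subsetP => z zC; have [->//|zx] := eqVneq z x; apply: (subsetP CB);
    rewrite !inE zx.
have [z zB bz] := indep_augment iCy (etrans cy Cr) bB.
exists B; split=> //; first by apply: (subsetP CB); rewrite !inE eq_sym xy.
move: zB; rewrite !inE negb_and negbK => /andP[zCy zB].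
have zy : z != y.
  apply: contra (circuit_dep cC) => /eqP zy; apply: basis_indep.
  by rewrite zy setD1K in bz.
have zC : z \notin C by rewrite (negbTE zy) in zCy.
suff -> : x |: (B :\ y) = z |: (C :\ y) by [].
have BE : B = z |: (C :\ x).
  apply/esym/eqP; rewrite eqEcard cardsU1 !inE (negbTE zC) andbF/=
    add1n cx Cr (basis_rank bB) leqnn andbT.
  by apply/subsetP => t; rewrite in_setU1 => /orP[/eqP->//|/(subsetP CB)].
apply/setP => t; rewrite BE !inE.
have [->|tx] := eqVneq t x; first by rewrite xC xy !orbT.
have [->|ty] := eqVneq t y; first by rewrite eq_sym (negbTE zy).
by rewrite andTb.
Qed.

Lemma connected_rank_gt0 x y : x != y -> (0 < matroid_rank M)%N.
Proof.
move=> xy; have [B [bB _ yB _]] := connected_exchange xy.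
by rewrite -(basis_rank bB); apply/card_gt0P; exists y.
Qed.

End Bases.

(* Imported only now, since the notations for classical sets shadow those of
   finite sets. *)
From mathcomp Require Import all_classical all_reals all_analysis.
From mathcomp Require Import measurable_realfun ring lra.

Import Order.TTheory GRing.Theory Num.Theory.
Import numFieldNormedType.Exports.
Local Open Scope ring_scope.

(** * Lebesgue measure on row vectors *)

Section MeasurableRow.
Context (R : realType).
Local Open Scope classical_set_scope.
Local Notation tup d := (d.-tuple (measurableTypeR R)).
Local Notation mu := (@lebesgue_measure R).

Lemma product_sigma_finite d1 d2 (T1 : measurableType d1)
    (T2 : measurableType d2) (m1 : {sigma_finite_measure set T1 -> \bar R})
    (m2 : {sigma_finite_measure set T2 -> \bar R}) :
  sigma_finite setT (m1 \x m2)%E.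
Proof.
have /sigma_finiteP[F [TF ndF Foo]] := sigma_finiteT m1.
have /sigma_finiteP[G [TG ndG Goo]] := sigma_finiteT m2.
exists (fun k => F k `*` G k).
  apply/esym/seteqP; split=> // -[x y] _.
  have [i _ Fx] : (\bigcup_k F k) x by rewrite -TF.
  have [j _ Gy] : (\bigcup_k G k) y by rewrite -TG.
  exists (maxn i j) => //; split => /=.
  - by move: x Fx; exact/subsetPset/ndF/leq_maxl.
  - by move: y Gy; exact/subsetPset/ndG/leq_maxr.
move=> k; have [mF Fk] := Foo k; have [mG Gk] := Goo k.
split; first exact: measurableX.
by rewrite product_measure1E// lte_mul_pinfty// ge0_fin_numE.
Qed.

(** Restricting m to the full space gives a copy of m, equal as a function, to which the
    sigma-finite structure can be attached inside a proof. *)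
Lemma sigma_finite_measureP d0 (T : measurableType d0)
    (m : {measure set T -> \bar R}) :
  sigma_finite setT m ->
  exists M : {sigma_finite_measure set T -> \bar R}, (m : set T -> \bar R) = M.
Proof.
move=> sf; pose f := mrestr m (@measurableT _ T).
have fE : f = m by apply/funext => A; rewrite /f /mrestr setIT.
have sff : sigma_finite setT f by rewrite fE.
pose sfm := Measure_isSigmaFinite.Build _ _ _ (mrestr m (@measurableT _ T)) sff.
pose M : {sigma_finite_measure set T -> \bar R} :=
  HB.pack (mrestr m (@measurableT _ T)) sfm.
by exists M; rewrite -fE.
Qed.

(** The fixpoint [lebesgue_tuple] is a bare set function; the induction carries a bundled measure
    equal to it, so that the product measure is available at the next dimension. *)
Lemma lebesgue_tuple_sigma_finite d :
  exists m : {sigma_finite_measure set (tup d) -> \bar R},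
    @lebesgue_tuple R d = m.
Proof.
elim: d => [|d [m IH]]; first by exists (@dirac _ _ [tuple] R).
pose cns (p : measurableTypeR R * tup d) : tup d.+1 := [tuple of p.1 :: p.2].
have mcns : measurable_fun setT cns by exact: measurable_cons.
pose uncns (t : tup d.+1) : measurableTypeR R * tup d :=
  (thead t, [tuple of behead t]).
have muncns : measurable_fun setT uncns.
  apply/measurable_fun_pairP; split.
  - exact: measurable_tnth.
  - exact: measurable_behead.
have cnsK p : uncns (cns p) = p.
  by case: p => x t; congr pair; apply: val_inj.
pose pf : {measure set (tup d.+1) -> \bar R} := pushforward (mu \x m)%E cns.
pose m' : {measure set (tup d.+1) -> \bar R} := pf mcns.
have sf : sigma_finite setT m'.
  have [F TF Foo] := product_sigma_finite mu m.
  exists (fun k => uncns @^-1` F k).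
    by rewrite -preimage_bigcup -TF.
  move=> k; have [mF Fk] := Foo k; split.
    by rewrite -[_ @^-1` _]setTI; exact: muncns.
  rewrite /m' /= /pushforward -comp_preimage.
  by rewrite (_ : uncns \o cns = id)//; apply/funext => p; exact: cnsK.
have [M mM] := sigma_finite_measureP sf; exists M; rewrite -mM.
by rewrite /= IH.
Qed.

Definition row_of_tuple d (t : tup d) : 'rV[R]_d := \row_i tnth t i.

(** The sigma-algebra of tuples, transported to row vectors, so that [lebesgue_row] is an image
    measure. *)
Let row_measurable d : set (set 'rV[R]_d) :=
  [set A | measurable (row_of_tuple (d := d) @^-1` A)].

Let row_measurable0 d : @row_measurable d set0.
Proof. by rewrite /row_measurable/= preimage_set0. Qed.

Let row_measurableC d A : @row_measurable d A -> @row_measurable d (~` A).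
Proof. by rewrite /row_measurable/= -preimage_setC; exact: measurableC. Qed.

Let row_measurable_bigcup d (F : _^nat) : (forall i, @row_measurable d (F i)) ->
  @row_measurable d (\bigcup_i (F i)).
Proof.
move=> mF; rewrite /row_measurable/= preimage_bigcup.
by apply: bigcupT_measurable => k; exact: mF.
Qed.

HB.instance Definition _ d := @isMeasurable.Build default_measure_display
  'rV[R]_d (@row_measurable d) (@row_measurable0 d) (@row_measurableC d)
  (@row_measurable_bigcup d).

Lemma measurable_row_of_tuple d : measurable_fun setT (@row_of_tuple d).
Proof. by move=> _ A mA; rewrite setTI. Qed.

Lemma measurable_rowP d0 (T : measurableType d0) d (f : T -> 'rV[R]_d) :
  measurable_fun setT f <->
  forall i, measurable_fun setT (fun x => f x ord0 i : measurableTypeR R).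
Proof.
split=> [mf i _ A mA|mf].
  have -> : setT `&` (fun x => f x ord0 i : measurableTypeR R) @^-1` A =
      setT `&` f @^-1` [set v : 'rV[R]_d | A (v ord0 i)] by [].
  apply: mf => //; rewrite /measurable/=.
  have := @measurable_tnth _ (measurableTypeR R) d i measurableT A mA.
  rewrite setTI; congr measurable; apply/seteqP; split=> t /=;
   by rewrite /preimage/= mxE.
pose g x : tup d := [tuple (f x ord0 i : measurableTypeR R) | i < d].
have -> : f = @row_of_tuple d \o g.
  by apply/funext => x; apply/rowP => i; rewrite /= mxE tnth_mktuple.
apply: measurableT_comp; first exact: measurable_row_of_tuple.
apply/measurable_fun_tnthP => i.
by apply: eq_measurable_fun (mf i) => x _ /=; rewrite tnth_mktuple.
Qed.

Lemma measurable_coord d (i : 'I_d) :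
  measurable_fun setT (fun v : 'rV[R]_d => v ord0 i : measurableTypeR R).
Proof. by move: i; apply/measurable_rowP; exact: measurable_id. Qed.

Lemma lebesgue_row_sigma_finite d :
  exists m : {sigma_finite_measure set 'rV[R]_d -> \bar R},
    @lebesgue_row R d = m.
Proof.
have [m mE] := lebesgue_tuple_sigma_finite d.
pose pf : {measure set 'rV[R]_d -> \bar R} := pushforward m (@row_of_tuple d).
pose m' : {measure set 'rV[R]_d -> \bar R} := pf (@measurable_row_of_tuple d).
have sf : sigma_finite setT m'.
  have [F TF Foo] := sigma_finiteT m.
  pose g (v : 'rV[R]_d) : tup d := [tuple (v ord0 i : measurableTypeR R) | i < d].
  have mg : measurable_fun setT g.
    apply/measurable_fun_tnthP => i.
    apply: eq_measurable_fun (@measurable_coord d i) => x _ /=.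
    by rewrite tnth_mktuple.
  have gK : g \o @row_of_tuple d = id.
    apply/funext => t; apply: eq_from_tnth => i.
    by rewrite tnth_mktuple mxE.
  exists (fun k => g @^-1` F k).
    by rewrite -preimage_bigcup -TF.
  move=> k; have [mF Fk] := Foo k; split.
    by rewrite -[_ @^-1` _]setTI; exact: mg.
  by rewrite /m' /= /pushforward -comp_preimage gK.
have [M mM] := sigma_finite_measureP sf; exists M; rewrite -mM.
by rewrite /= /lebesgue_row mE.
Qed.

Lemma lebesgue_rowS d (A : set 'rV[R]_(1 + d)) :
  @lebesgue_row R (1 + d) A =
  (\int[mu]_x @lebesgue_row R d [set v | A (row_mx (x%:M) v)])%E.
Proof.
rewrite /lebesgue_row /= /pushforward /product_measure1.
apply: eq_integral => x _ /=; congr lebesgue_tuple.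
apply/seteqP; split=> t; rewrite /xsection /= ?inE /=;
  congr A; apply/rowP => i; rewrite !mxE; case: splitP => j ij.
- by rewrite ord1 mxE eqxx (_ : i = ord0)//; apply: val_inj; rewrite /= ij ord1.
- by rewrite mxE (_ : i = lift ord0 j) ?tnthS//; exact: val_inj.
- by rewrite ord1 mxE eqxx (_ : i = ord0)//; apply: val_inj; rewrite /= ij ord1.
- by rewrite mxE (_ : i = lift ord0 j) ?tnthS//; exact: val_inj.
Qed.

End MeasurableRow.

Section LebesgueRowMeasure.
Context (R : realType) (d : nat).
Local Open Scope classical_set_scope.

Let lebesgue_row0 : @lebesgue_row R d set0 = 0%E.
Proof. by have [m ->] := @lebesgue_row_sigma_finite R d; exact: measure0. Qed.

Let lebesgue_row_ge0 A : (0 <= @lebesgue_row R d A)%E.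
Proof. by have [m ->] := @lebesgue_row_sigma_finite R d; exact: measure_ge0. Qed.

Let lebesgue_row_sigma_additive : semi_sigma_additive (@lebesgue_row R d).
Proof.
have [m ->] := @lebesgue_row_sigma_finite R d.
exact: measure_semi_sigma_additive.
Qed.

HB.instance Definition _ := isMeasure.Build _ _ _ (@lebesgue_row R d)
  lebesgue_row0 lebesgue_row_ge0 lebesgue_row_sigma_additive.

Let lebesgue_row_sf : sigma_finite setT (@lebesgue_row R d).
Proof.
by have [m ->] := @lebesgue_row_sigma_finite R d; exact: sigma_finiteT.
Qed.

HB.instance Definition _ := Measure_isSigmaFinite.Build _ _ _
  (@lebesgue_row R d) lebesgue_row_sf.

End LebesgueRowMeasure.

(** * Affine changes of variables for Lebesgue measure on row vectors *)

Section LinearChange.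
Context (R : realType).
Local Open Scope classical_set_scope.
Local Notation mu := (@lebesgue_measure R).

Lemma measurable_affine1 (a b : R) :
  measurable_fun setT (fun x : measurableTypeR R => (a * x + b : measurableTypeR R)).
Proof. by apply: measurable_funD => //; apply: measurable_funM. Qed.

(** A negative a moves the open end of the interval from left to right; [s] records the side. *)
Lemma preimage_affine_itv (a b u v : R) : a != 0 ->
  exists i j : R, (j - i = `|a|^-1 * (v - u)) /\
  exists s, [set x | u < a * x + b <= v] = [set` Interval (BSide s i) (BSide s j)].
Proof.
rewrite neq_lt => /orP[a0|a0].
  exists ((v - b) / a), ((u - b) / a); split.
    rewrite ltr0_norm// invrN; field; lra.
  exists true; apply/seteqP; split=> x /=; rewrite in_itv/=
    ler_ndivrMr// ltr_ndivlMr// => /andP[h1 h2]; apply/andP; split; lra.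
exists ((u - b) / a), ((v - b) / a); split.
  rewrite gtr0_norm//; field; lra.
exists false; apply/seteqP; split=> x /=; rewrite in_itv/=
  ler_pdivlMr// ltr_pdivrMr// => /andP[h1 h2]; apply/andP; split; lra.
Qed.

(** The image of Lebesgue measure under the affine map, scaled by the absolute value of a, agrees
    with Lebesgue measure on half-open intervals, hence everywhere by uniqueness. *)
Lemma lebesgue_measure_affine (a b : R) (A : set R) : a != 0 ->
  measurable (A : set (measurableTypeR R)) ->
  mu [set x | A (a * x + b)] = (`|a|^-1%:E * mu A)%E.
Proof.
move=> a0 mA.
pose pf : {measure set (measurableTypeR R) -> \bar R} :=
  pushforward mu (fun x : measurableTypeR R => (a * x + b : measurableTypeR R)).
pose m : {measure set (measurableTypeR R) -> \bar R} :=
  mscale (NngNum (normr_ge0 a)) (pf (measurable_affine1 a b)).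
have aE : (`|a|^-1%:E * `|a|%:E = 1%E)%E.
  by rewrite -EFinM mulVf// normr_eq0.
rewrite [X in (_ = _ * X)%E](@lebesgue_measure_unique _ m)//;
  first by rewrite /m/= /mscale/= muleA aE mul1e.
move=> _ [[u v] /= uv <-].
rewrite /m/= /mscale/= /pf/= /pushforward/=.
have [i [j [ij [s sE]]]] := preimage_affine_itv b u v a0.
rewrite (_ : _ @^-1` _ = [set` Interval (BSide s i) (BSide s j)]); last first.
  by rewrite -sE; apply/seteqP; split=> x /=; rewrite in_itv.
rewrite !lebesgue_measure_itv/= !lte_fin.
have aij : `|a| * (j - i) = v - u by rewrite ij mulrA divff ?mul1r ?normr_eq0.
have a1 : 0 < `|a| by rewrite normr_gt0.
have -> : (i < j) = (u < v).
  by rewrite -subr_gt0 -[RHS]subr_gt0 -aij pmulr_rgt0.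
by case: ifP => _; rewrite ?mule0// -!EFinB -EFinM aij.
Qed.

Lemma integral_affine (a b : R) (f : measurableTypeR R -> \bar R) : a != 0 ->
  measurable_fun setT f -> (forall x, 0 <= f x)%E ->
  (\int[mu]_x f (a * x + b)%R = `|a|^-1%:E * \int[mu]_x f x)%E.
Proof.
move=> a0 mf f0.
pose phi := (fun x : measurableTypeR R => (a * x + b : measurableTypeR R)).
pose pf : {measure set (measurableTypeR R) -> \bar R} := pushforward mu phi.
pose m : {measure set (measurableTypeR R) -> \bar R} := pf (measurable_affine1 a b).
have a1 : 0 <= `|a|^-1 by rewrite invr_ge0.
transitivity (\int[m]_y f y)%E.
  rewrite (@ge0_integral_pushforward _ _ _ _ R _ (measurable_affine1 a b))//.
transitivity (\int[mscale (NngNum a1) mu]_x f x)%E.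
  by apply: eq_measure_integral => A mA _; exact: lebesgue_measure_affine.
by rewrite ge0_integral_mscale.
Qed.

Lemma measurable_row_mx d :
  measurable_fun setT (fun p : measurableTypeR R * 'rV[R]_d => row_mx (p.1%:M) p.2 :
    'rV[R]_(1 + d)).
Proof.
apply/measurable_rowP => i; rewrite -[i]splitK; case: (fintype.split i) => j /=.
  apply: eq_measurable_fun measurable_fst => -[x v] _.
  by rewrite row_mxEl !ord1 mxE eqxx.
apply: (@eq_measurable_fun _ _ _ _ _ ((fun v : 'rV[R]_d => v ord0 j) \o snd)).
  by move=> -[x v] _; rewrite row_mxEr.
by apply: measurableT_comp => //; exact: measurable_coord.
Qed.

Lemma measurable_affine d0 (T : measurableType d0) d e (f : T -> 'rV[R]_d)
  (G : 'M[R]_(d, e)) (p : 'rV[R]_e) :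
  measurable_fun setT f ->
  measurable_fun setT (fun t => f t *m G + p).
Proof.
move=> mf; apply/measurable_rowP => i.
apply: (@eq_measurable_fun _ _ _ _ _ (fun t => \sum_j f t ord0 j * G j i + p ord0 i)).
  by move=> t _; rewrite !mxE.
apply: measurable_funD => //; apply: measurable_sum => j.
by apply: measurable_funM => //; move: j; apply/measurable_rowP.
Qed.

Lemma measurable_preimage_affine d e (G : 'M[R]_(d, e)) (p : 'rV[R]_e) (A : set 'rV[R]_e)
  :
  measurable A -> measurable [set v | A (v *m G + p)].
Proof.
move=> mA; rewrite -[X in measurable X]setTI.
exact: (measurable_affine G p (@measurable_id _ _ setT)).
Qed.

(** The other order of integration: the shear below moves the first coordinate by an amount that
    depends on the remaining ones, which therefore have to be fixed first. *)
Lemma lebesgue_rowS_fubini d (A : set 'rV[R]_(1 + d)) : measurable A ->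
  lebesgue_row A =
  (\int[@lebesgue_row R d]_v mu [set x | A (row_mx (x%:M) v)])%E.
Proof.
move=> mA; pose A2 := [set p : measurableTypeR R * 'rV[R]_d | A (row_mx (p.1%:M) p.2)].
have mA2 : measurable A2.
  by rewrite /A2 -[X in measurable X]setTI; exact: measurable_row_mx.
transitivity ((mu \x @lebesgue_row R d)%E A2).
  rewrite lebesgue_rowS; apply: eq_integral => x _ /=; congr lebesgue_row.
  by apply/seteqP; split=> v; rewrite /xsection /= inE.
transitivity ((mu \x^ @lebesgue_row R d)%E A2).
  by apply: product_measure_unique => //= *; rewrite product_measure2E.
apply: eq_integral => v _ /=; congr lebesgue_measure.
by apply/seteqP; split=> x; rewrite /ysection /= inE.
Qed.

Lemma lebesgue_row_shear d (c : 'cV[R]_d) (A : set 'rV[R]_(1 + d)) : measurable A ->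
  lebesgue_row [set w : 'rV[R]_(1 + d) | A (w *m block_mx 1%:M 0 c 1%:M)] =
    lebesgue_row A.
Proof.
move=> mA.
rewrite lebesgue_rowS_fubini; last first.
  by under eq_set do rewrite -[X in A X]addr0; exact: measurable_preimage_affine.
rewrite lebesgue_rowS_fubini//; apply: eq_integral => v _.
pose s := (v *m c) 0 0.
have mAv : measurable ([set x | A (row_mx (x%:M) v)] : set (measurableTypeR R)).
  have := @measurable_row_mx d measurableT A mA; rewrite setTI => mA2.
  have := measurable_ysection v mA2.
  by congr measurable; apply/seteqP; split=> x; rewrite /ysection /= inE.
have := @lebesgue_measure_affine 1 s _ (oner_neq0 R) mAv.
rewrite normr1 invr1 mul1e => <-; congr lebesgue_measure.
apply/seteqP; split=> x /=; congr (A _);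
  rewrite mul_row_block !mulmx1 mulmx0 add0r; congr row_mx;
  by rewrite [v *m c]mx11_scalar -raddfD mul1r.
Qed.


(** At a fixed first coordinate x the others undergo E followed by a translation depending on x,
    which [IH] covers; x itself undergoes a one-dimensional affine map. *)
Lemma lebesgue_row_block d (a : R) (b : 'rV[R]_d) (E : 'M[R]_d) (p : 'rV[R]_(1 + d))
  (A : set 'rV[R]_(1 + d)) :
  (forall (q : 'rV[R]_d) (B : set 'rV[R]_d), measurable B ->
    lebesgue_row [set v | B (v *m E + q)] = (`|\det E|^-1%:E * lebesgue_row B)%E) ->
  a != 0 -> measurable A ->
  lebesgue_row [set w : 'rV[R]_(1 + d) | A (w *m block_mx a%:M b 0 E + p)] =
    (`|a * \det E|^-1%:E * lebesgue_row A)%E.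
Proof.
move=> IH a0 mA; rewrite lebesgue_rowS.
have rowE x (v : 'rV[R]_d) : row_mx (x%:M) v *m block_mx a%:M b 0 E + p =
    row_mx ((a * x + p 0 0)%:M) (v *m E + (x *: b + rsubmx p)).
  rewrite mul_row_block mulmx0 addr0 -{1}[p]hsubmxK add_row_mx; congr row_mx.
    rewrite -scalar_mxM [lsubmx p]mx11_scalar -raddfD mulrC; congr (_ + _)%:M.
    by rewrite mxE; congr (p _ _); apply: val_inj.
  by rewrite mul_scalar_mx [_ + v *m E]addrC addrA.
pose f x := @lebesgue_row R d [set v | A (row_mx (x%:M) v)].
have mA2 := @measurable_row_mx d measurableT A mA; rewrite setTI in mA2.
have mf : measurable_fun setT (f : measurableTypeR R -> \bar R).
  have := measurable_fun_xsection (@lebesgue_row R d) mA2.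
  apply: eq_measurable_fun => x _ /=; congr lebesgue_row.
  by apply/seteqP; split=> v; rewrite /xsection /= inE.
have mAx x : measurable [set v | A (row_mx (x%:M) v)].
  have := measurable_xsection x mA2.
  by congr measurable; apply/seteqP; split=> v; rewrite /xsection /= inE.
transitivity (\int[mu]_x (`|\det E|^-1%:E * f (a * x + p 0 0)%R))%E.
  apply: eq_integral => x _.
  rewrite -(IH (x *: b + rsubmx p))//; congr lebesgue_row.
  apply/seteqP; split=> v /=; congr (A _); first by rewrite rowE.
  by rewrite rowE.
rewrite ge0_integralZl//; last first.
  by apply: (measurableT_comp mf); exact: measurable_affine1.
rewrite (integral_affine _ a0)// muleA lebesgue_rowS; congr (_ * _)%E.
by rewrite normrM invfM EFinM muleC.
Qed.

(* Induction on d by block elimination: a nonzero pivot splits G into a shear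
   and a block triangular matrix; a zero pivot is first made nonzero by adding
   a multiple of the first coordinate to another one. *)
Lemma lebesgue_row_affine d (G : 'M[R]_d) (p : 'rV[R]_d) (A : set 'rV[R]_d) :
  G \in unitmx -> measurable A ->
  lebesgue_row [set v | A (v *m G + p)] = (`|\det G|^-1%:E * lebesgue_row A)%E.
Proof.
elim: d G p A => [|d IH] G p A uG mA.
  by rewrite det_mx00 normr1 invr1 mul1e; congr lebesgue_row;
    apply/seteqP; split=> v /=; rewrite !thinmx0.
have nz (a : R) (b : 'rV[R]_d) c E q B : a != 0 ->
    (block_mx a%:M b c E : 'M[R]_(1 + d)) \in unitmx -> measurable B ->
    lebesgue_row [set v : 'rV[R]_(1 + d) | B (v *m block_mx a%:M b c E + q)]
      = (`|\det (block_mx a%:M b c E)|^-1%:E * lebesgue_row B)%E.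
  move=> a0 uM mB.
  pose c' := a^-1 *: c.
  (* The Schur complement of the pivot. *)
  pose E' := E - c' *m b.
  have ME : block_mx a%:M b c E = block_mx 1%:M 0 c' 1%:M *m block_mx a%:M b 0 E'.
    rewrite mulmx_block !mul1mx !mul0mx !addr0 /E' addrC subrK.
    by rewrite mul_mx_scalar /c' scalerA divff// scale1r.
  have detM : \det (block_mx a%:M b c E) = a * \det E'.
    by rewrite ME det_mulmx det_lblock det_ublock !det1 !mul1r det_scalar1.
  have uE' : E' \in unitmx.
    by move: uM; rewrite !unitmxE detM !unitfE mulf_eq0 negb_or => /andP[].
  rewrite ME; under eq_set do rewrite mulmxA.
  have := @lebesgue_row_shear d c' [set w | B (w *m block_mx a%:M b 0 E' + q)].
  move=> /= ->; last exact: measurable_preimage_affine.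
  rewrite (lebesgue_row_block _ _ _ a0)//; first by rewrite -ME detM.
  by move=> q' B' mB'; exact: IH.
rewrite -[G](@submxK R 1 d 1 d) in uG *.
move: (ulsubmx _) (ursubmx _) (dlsubmx _) (drsubmx _) uG => a b c E.
rewrite [a]mx11_scalar; move: (a 0 0) => {}a.
have [->|] := eqVneq a 0; last by move=> a0 uM; exact: nz.
move=> uM.
have [j cj] : exists j, c j 0 != 0.
  apply/existsP; apply: contraTT uM; rewrite negb_exists => /forallP c0.
  have -> : c = 0.
    by apply/colP => j; rewrite mxE; apply/eqP; move: (c0 j); rewrite negbK.
  by rewrite unitmxE (@det_ublock _ 1 d) det_scalar1 mul0r unitr0.
pose e : 'rV[R]_d := delta_mx 0 j.
pose F0 : 'M[R]_(1 + d) := block_mx 1%:M e 0 1%:M.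
pose G' : 'M[R]_(1 + d) := block_mx (- c j 0)%:M (b - e *m E) c E.
have ME : block_mx 0%:M b c E = F0 *m G'.
  rewrite mulmx_block !mul1mx !mul0mx !add0r subrK; congr block_mx.
  by rewrite -rowE [row j c]mx11_scalar mxE -raddfD addNr.
have detG' : \det (block_mx 0%:M b c E) = \det G'.
  by rewrite ME det_mulmx det_ublock !det1 !mul1r.
rewrite detG' ME; under eq_set do rewrite mulmxA.
have -> : [set v : 'rV[R]_(1 + d) | A (v *m F0 *m G' + p)] =
    [set v | [set w | A (w *m G' + p)] (v *m F0 + 0)].
  by apply/seteqP; split => v /=; rewrite addr0.
rewrite (lebesgue_row_block _ _ _ (oner_neq0 R)); last 2 first.
- by move=> q' B' mB'; apply: IH => //; exact: unitmx1.
- exact: measurable_preimage_affine.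
rewrite det1 mulr1 normr1 invr1 mul1e nz ?oppr_eq0//.
by move: uM; rewrite !unitmxE detG'.
Qed.

End LinearChange.

(** * Finite intersections, partitions and null unions *)

Section FiniteMeasurability.
Context d (T : measurableType d) (R : realType).
Local Open Scope classical_set_scope.

Lemma measurable_forall (I : finType) (F : I -> set T) :
  (forall i, measurable (F i)) -> measurable [set x | forall i, F i x].
Proof.
move=> mF; rewrite (_ : [set x | _] = \bigcap_(i in [set: I]) F i).
  by apply: fin_bigcap_measurable => // ; exact: finite_finset.
by apply/seteqP; split=> x h i //; exact: h.
Qed.

Lemma measurable_pred (P : T -> bool) :
  measurable_fun setT P -> measurable [set x | P x].
Proof.
move=> mP; have := mP measurableT [set true] I; rewrite setTI.
by congr measurable; apply/seteqP; split=> x.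
Qed.

(** Applied with f the standardization, the jump set and the violated hyperplane. *)
Lemma measure_fibers (mu : {measure set T -> \bar R}) (I : finType) (P : pred I)
    (D : set T) (f : T -> I) :
  (forall i, P i -> measurable [set x | D x /\ f x = i]) ->
  mu [set x | D x /\ P (f x)] = (\sum_(i | P i) mu [set x | D x /\ f x = i])%E.
Proof.
move=> mF.
have -> : [set x | D x /\ P (f x)] =
    \bigcup_(i in [set i | P i]) [set x | D x /\ f x = i].
  apply/seteqP; split=> x; first by case=> Dx Pfx; exists (f x).
  by case=> i Pi [Dx fi]; rewrite /= fi.
rewrite measure_fin_bigcup//.
- rewrite (fsbigE (enum P)) ?enum_uniq//.
  + rewrite big_mkcond/= [LHS]big_seq -[RHS]big_enum [RHS]big_seq.
    by apply: eq_bigr => i iP; rewrite ifT// inE; move: iP; rewrite mem_enum.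
  + by move=> i /=; rewrite mem_enum.
  + by move=> i /= Pi; rewrite mem_enum -topredE/= Pi.
- exact: finite_finset.
- by move=> i j _ _ [x [[_ <-] [_ <-]]].
Qed.

Lemma measure_exists0 (mu : {measure set T -> \bar R}) (I : finType)
    (F : I -> set T) :
  (forall i, measurable (F i)) -> (forall i, mu (F i) = 0%E) ->
  measurable [set x | exists i, F i x] /\ mu [set x | exists i, F i x] = 0%E.
Proof.
move=> mF F0; pose G k := if unpickle k is Some i then F i else set0.
have -> : [set x | exists i, F i x] = \bigcup_k G k.
  apply/seteqP; split=> x; first by case=> i Fi; exists (pickle i); rewrite // /G pickleK.
  by case=> k _; rewrite /G; case: unpickle => // i Fi; exists i.
have mG k : measurable (G k) by rewrite /G; case: unpickle.
have mU : measurable (\bigcup_k G k) by exact: bigcupT_measurable.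
split=> //; apply/negligibleP => //; apply: negligible_bigcup => k.
by apply/negligibleP => //; rewrite /G; case: unpickle => // _; rewrite measure0.
Qed.

End FiniteMeasurability.

(** * Affine hyperplanes are null; the unit cube has volume 1 *)

Section NullHyperplane.
Context (R : realType).
Local Open Scope classical_set_scope.
Local Notation mu := (@lebesgue_measure R).

Lemma measurable_linear d (c : 'cV[R]_d) :
  measurable_fun setT (fun v : 'rV[R]_d => (v *m c) 0 0 : measurableTypeR R).
Proof.
have := measurable_affine c 0 (@measurable_id _ 'rV[R]_d setT).
move=> /measurable_rowP/(_ ord0); apply: eq_measurable_fun => v _ /=.
by rewrite addr0.
Qed.

Lemma measurable_hyperplane d (c : 'cV[R]_d) (b : R) :
  measurable [set v : 'rV[R]_d | (v *m c) 0 0 = b].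
Proof.
have := measurable_pred (measurable_fun_eqr (measurable_linear c)
  (@measurable_cst _ _ _ _ setT b)).
by congr measurable; apply/seteqP; split=> v /= /eqP.
Qed.

(** If the first coefficient vanishes, every slice at a fixed first coordinate is a hyperplane one
    dimension lower; otherwise every line in the first direction meets the set in one point. *)
Lemma lebesgue_row_hyperplane d (c : 'cV[R]_d) (b : R) : c != 0 ->
  lebesgue_row [set v : 'rV[R]_d | (v *m c) 0 0 = b] = 0%E.
Proof.
elim: d c b => [|d IH] c b c0; first by rewrite [c]flatmx0 eqxx in c0.
move: c c0; change d.+1 with (1 + d)%N => c; rewrite -[c]vsubmxK.
move: (usubmx c) (dsubmx c) => a {}c; rewrite [a]mx11_scalar; move: (a 0 0) => {}a nz.
have lE x (v : 'rV[R]_d) : (row_mx x%:M v *m col_mx a%:M c) 0 0 = x * a + (v *m c) 0 0.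
  by rewrite mul_row_col -scalar_mxM mxE [in X in X + _]mxE eqxx.
have [a0|a0] := eqVneq a 0.
  have c0 : c != 0.
    by apply: contraNneq nz => ->; rewrite a0 raddf0 col_mx0.
  rewrite lebesgue_rowS; apply: integral0_eq => x _.
  rewrite -(IH c (b - x * a) c0); congr lebesgue_row.
  by apply/seteqP; split=> v /=; rewrite lE => h; lra.
rewrite lebesgue_rowS_fubini; last exact: measurable_hyperplane.
apply: integral0_eq => v _.
rewrite -(@lebesgue_measure_set1 R ((b - (v *m c) 0 0) / a)); congr lebesgue_measure.
apply/seteqP; split=> x /=; rewrite lE.
  by move=> <-; rewrite addrK mulfK.
by move=> ->; rewrite mulfVK// subrK.
Qed.

Lemma lebesgue_row_fibers m (I : finType) (P : pred I) (D : set 'rV[R]_m)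
    (f : 'rV[R]_m -> I) :
  (forall i, P i -> measurable [set x | D x /\ f x = i]) ->
  lebesgue_row [set x | D x /\ P (f x)] =
  (\sum_(i | P i) lebesgue_row [set x | D x /\ f x = i])%E.
Proof. exact: measure_fibers. Qed.

Lemma lebesgue_row_cube d :
  lebesgue_row [set v : 'rV[R]_d | forall i, 0 <= v 0 i < 1] = 1%E.
Proof.
elim: d => [|d IH].
  by rewrite /lebesgue_row/= diracE mem_set// => -[].
transitivity (\int[mu]_x (\1_(`[0, 1[ : set R) x)%:E)%E; last first.
  rewrite integral_indic// setIT; etransitivity; first exact: lebesgue_measure_itv.
  by rewrite /= lte_fin ltr01 sube0.
rewrite (@lebesgue_rowS R d); apply: eq_integral => x _.
rewrite indicE; case: (boolP (x \in `[0, 1[%classic)) => [|/negP] x01.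
  rewrite -IH; congr lebesgue_row; apply/seteqP; split=> v /= v01 i.
    by have := v01 (rshift 1 i); rewrite (@row_mxEr _ 1 1 d).
  rewrite -[i](@splitK 1 d); case: (fintype.split _) => j /=;
    last by rewrite (@row_mxEr _ 1 1 d).
  by move: x01; rewrite inE/= in_itv/= (@row_mxEl _ 1 1 d) ord1 mxE.
rewrite (_ : [set v | _] = set0) ?measure0//.
apply/seteqP; split=> // v /= /(_ (@lshift 1 d 0)); rewrite (@row_mxEl _ 1 1 d) mxE => h.
by apply: x01; rewrite inE/= in_itv.
Qed.

End NullHyperplane.

(** * Order chambers of the cube and descents *)

Lemma letterE m (w : 'S_m) (i : 'I_m) : letter w i.+1 = (w i).+1.
Proof.
rewrite /letter (nth_map i) ?size_enum_ord//=; congr _.+1.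
by congr (val (w _)); apply: val_inj; rewrite /= nth_enum_ord.
Qed.

(* Fixes 0; only used at positive ordinals. *)
Definition pred_ord m (i : 'I_m) : 'I_m :=
  Ordinal (leq_ltn_trans (leq_pred i) (ltn_ord i)).

(** A descent at position i compares the letters i and i + 1, that is, the values of w at the
    ordinals i - 1 and i. *)
Lemma mem_Des m (w : 'S_m) (i : 'I_m) :
  (i \in Des w) = (0 < i)%N && (w i < w (pred_ord i))%N.
Proof.
rewrite inE; case: ltnP => //= i0.
by rewrite letterE -[X in letter w X](prednK i0) (letterE w (pred_ord i)) ltnS.
Qed.

Section Standardization.
Context (R : realType) (m : nat).
Implicit Types (y : 'rV[R]_m) (w : 'S_m) (i j : 'I_m).
Local Open Scope classical_set_scope.

(* Ties are broken by position, so that the chambers partition the cube exactly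
   and the strict descents of y are those of its standardization. *)
Definition before y i j : bool :=
  (y 0 i < y 0 j) || ((y 0 i == y 0 j) && (i < j)%N).

Lemma before_irr y i : before y i i = false.
Proof. by rewrite /before !ltxx ltnn andbF. Qed.

Lemma before_trans y : transitive (before y).
Proof.
move=> j i k; rewrite /before => /orP[ij|/andP[/eqP ij ij']] /orP[jk|/andP[/eqP jk jk']].
- by rewrite (lt_trans ij jk).
- by rewrite -jk ij.
- by rewrite ij jk.
- by rewrite ij jk eqxx (ltn_trans ij' jk') orbT.
Qed.

Lemma before_total y i j : i != j -> before y i j || before y j i.
Proof.
move=> ij; rewrite /before; case: ltgtP => //= _.
by rewrite -neq_ltn.
Qed.

Definition place y i : nat := #|[set j : 'I_m | before y j i]%SET|.

Lemma place_lt y i j : (place y i < place y j)%N = before y i j.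
Proof.
have H a b : before y a b -> (place y a < place y b)%N.
  move=> ab; apply: proper_card; apply/properP; split.
    by apply/fintype.subsetP => k; rewrite !inE => ka; exact: before_trans ab.
  by exists a; rewrite !inE ?before_irr.
apply/idP/idP => [|/H//].
have [->|ij] := eqVneq i j; first by rewrite ltnn.
by case/orP: (before_total y ij) => // /H h1 h2; have := ltn_trans h1 h2; rewrite ltnn.
Qed.

Lemma place_bound y i : (place y i < m)%N.
Proof.
rewrite -[X in (_ < X)%N]card_ord -cardsT; apply: proper_card.
apply/properP; split; first by apply/fintype.subsetP => k; rewrite inE.
by exists i; rewrite ?inE ?before_irr.
Qed.

Definition place_ord y i : 'I_m := Ordinal (place_bound y i).

Lemma place_ord_inj y : injective (place_ord y).
Proof.
move=> i j [ij]; apply/eqP; apply/negPn/negP => /(before_total y).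
by rewrite -!place_lt ij ltnn.
Qed.

Definition std y : 'S_m := perm (@place_ord_inj y).

Lemma std_lt y i j : (std y i < std y j)%N = before y i j.
Proof. by rewrite !permE /= place_lt. Qed.

(** The value at i is the number of j with a smaller value, so the comparisons determine the
    permutation. *)
Lemma ltn_perm_inj w w' :
  (forall i j, (w i < w j)%N = (w' i < w' j)%N) -> w = w'.
Proof.
move=> h; apply/permP => i; apply: val_inj => /=.
have cnt (u : 'S_m) : (u i : nat) = #|[set j : 'I_m | (u j < u i)%N]%SET|.
  rewrite -(card_preimset _ (@perm_inj _ u^-1)%g).
  rewrite (_ : _ @^-1: _ = [set k : 'I_m | (k < u i)%N]%SET); last first.
    by apply/setP => k; rewrite !inE permKV.
  by rewrite cardsE -sum1_card (big_ord_narrow (ltnW (ltn_ord (u i)))) sum1_card card_ord.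
by rewrite (cnt w) (cnt w'); apply: eq_card => j; rewrite !inE h.
Qed.

Lemma stdP y w : reflect (forall i j, (w i < w j)%N = before y i j) (std y == w).
Proof.
apply: (iffP eqP) => [<- i j|h]; first exact: std_lt.
by apply: ltn_perm_inj => i j; rewrite h std_lt.
Qed.

Definition cube : set 'rV[R]_m := [set x | forall i, 0 <= x 0 i < 1].

Definition chamber w : set 'rV[R]_m := [set y | cube y /\ std y = w].

(** Tie-breaking by position is not invariant under permutations of the coordinates, so congruence
    is proved for these tie-free chambers, which differ from the others by a null set. *)
Definition open_chamber w : set 'rV[R]_m :=
  [set y | cube y /\ forall i j, (w i < w j)%N -> y 0 i < y 0 j].

Lemma measurable_cube : measurable cube.
Proof.
apply: measurable_forall => i; apply: measurable_pred.
apply: measurable_and; first exact: (measurable_fun_ler _ (measurable_coord _)).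
exact: (measurable_fun_ltr (measurable_coord _)).
Qed.

Lemma measurable_before i j : measurable [set y | before y i j].
Proof.
apply: measurable_pred; rewrite /before.
apply: measurable_or; first exact:
  (measurable_fun_ltr (measurable_coord _) (measurable_coord _)).
apply: measurable_and => //.
exact: (measurable_fun_eqr (measurable_coord _) (measurable_coord _)).
Qed.

Lemma measurable_chamber w : measurable (chamber w).
Proof.
have -> : chamber w = cube `&`
    [set y | forall i j, [set y | (w i < w j)%N = before y i j] y].
  by apply/seteqP; split=> y [cy h]; split=> //; [apply/stdP/eqP|apply/eqP/stdP].
apply: measurableI; first exact: measurable_cube.
apply: measurable_forall => i; apply: measurable_forall => j.
have := measurable_before i j.
case: (w i < w j)%N => mb.
  by congr measurable: mb; apply/seteqP; split=> y /=; [move->|move=> <-].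
move/measurableC: mb; congr measurable; apply/seteqP; split=> y /=.
  by move/negP/negbTE.
by move=> <-.
Qed.

Lemma measurable_open_chamber w : measurable (open_chamber w).
Proof.
apply: measurableI; first exact: measurable_cube.
apply: measurable_forall => i; apply: measurable_forall => j.
case: (w i < w j)%N; last first.
  by rewrite [X in measurable X](_ : _ = setT)//; apply/seteqP; split.
rewrite [X in measurable X](_ : _ = [set y : 'rV[R]_m | y 0 i < y 0 j]).
  apply: measurable_pred; exact: (measurable_fun_ltr (measurable_coord _)
    (measurable_coord _)).
by apply/seteqP; split=> y /=; [apply|].
Qed.

(** Ties are written as zeros of linear forms, ready for [lebesgue_row_hyperplane]. *)
Definition ties : set 'rV[R]_m :=
  [set y | exists p : 'I_m * 'I_m, (p.1 != p.2) /\
    (y *m (delta_mx p.1 0 - delta_mx p.2 0 : 'cV_m)) 0 0 = 0].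

Lemma mem_ties y i j : i != j -> y 0 i = y 0 j -> ties y.
Proof.
move=> ij yij; exists (i, j); split=> //=.
by rewrite mulmxBr -!colE !mxE yij subrr.
Qed.

Lemma ties_null : measurable ties /\ lebesgue_row ties = 0%E.
Proof.
apply: measure_exists0 => -[i j] /=; have [ij|ij] := boolP (i != j).
- rewrite [X in measurable X](_ :
  _ = [set y | (y *m (delta_mx i 0 - delta_mx j 0 : 'cV_m)) 0 0 = 0]).
    exact: measurable_hyperplane.
  by apply/seteqP; split=> y /=; [case|].
- by rewrite [X in measurable X](_ : _ = set0)//; apply/seteqP; split=> y // -[].
- rewrite -(@lebesgue_row_hyperplane R m (delta_mx i 0 - delta_mx j 0) 0).
    by congr lebesgue_row; apply/seteqP; split=> y /=; [case|].
  apply: contraNneq ij => /colP/(_ i); rewrite !mxE !eqxx/= andbT.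
  by case: eqP => // _ /eqP; rewrite subr0 oner_eq0.
- rewrite -(@measure0 _ _ _ (@lebesgue_row R m)); congr lebesgue_row.
  by apply/seteqP; split=> y // -[].
Qed.

Lemma chamber_open w : lebesgue_row (chamber w) = lebesgue_row (open_chamber w).
Proof.
have mo := measurable_open_chamber w.
apply/eqP; rewrite eq_le; apply/andP; split.
  rewrite -(measureU0 mo ties_null.1 ties_null.2).
  apply: le_measure; rewrite ?inE; first exact: measurable_chamber.
    by apply: measurableU => //; exact: ties_null.1.
  move=> y [cy /eqP/stdP h].
  have [yt|nt] := pselect (ties y); [by right|left; split=> // i j].
  rewrite h /before => /orP[//|/andP[/eqP yij ij]].
  by case: nt; apply: (mem_ties _ yij); rewrite neq_ltn ij.
apply: le_measure; rewrite ?inE //; first exact: measurable_chamber.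
move=> y [cy h]; split=> //; apply/eqP/stdP => i j.
apply/idP/idP => [/h ij|]; first by rewrite /before ij.
have [-> | ij] := eqVneq i j; first by rewrite before_irr.
move=> b; case: (ltngtP (w i) (w j)) => //.
  move=> /h ji; move: b; rewrite /before => /orP[yij|/andP[/eqP yij _]].
    by have := lt_trans yij ji; rewrite ltxx.
  by rewrite yij ltxx in ji.
by move=> /val_inj/perm_inj/eqP; rewrite (negbTE ij).
Qed.

Lemma open_chamber_perm w : lebesgue_row (open_chamber w) =
  lebesgue_row (open_chamber 1%g).
Proof.
have uP : perm_mx w^-1 \in @unitmx R m by rewrite unitmx_perm.
have := lebesgue_row_affine 0 uP (measurable_open_chamber w).
rewrite det_perm normrX normrN1 expr1n invr1 mul1e => <-; congr lebesgue_row.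
have pE (y : 'rV[R]_m) i : (y *m perm_mx w^-1 + 0) 0 i = y 0 (w i).
  by rewrite addr0 -col_permE mxE.
apply/seteqP; split=> y [cy h]; split=> /=.
- move=> i; have := cy (w^-1 i)%g; rewrite pE permKV//.
- move=> i j; rewrite !perm1 => ij.
  by have := h (w^-1 i)%g (w^-1 j)%g; rewrite !pE !permKV; exact.
- by move=> i; rewrite pE.
- by move=> i j ij; rewrite !pE; apply: h; rewrite !perm1.
Qed.

(** The m! chambers have equal volume and partition a cube of volume 1. *)
Lemma lebesgue_row_chamber w : lebesgue_row (chamber w) = (m`!%:R^-1)%:E.
Proof.
rewrite chamber_open open_chamber_perm.
have : lebesgue_row (cube) = 1%E :> \bar R by exact: lebesgue_row_cube.
have -> : cube = [set y | cube y /\ predT (std y)] by apply/seteqP; split=> y // -[].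
rewrite (@lebesgue_row_fibers _ _ _ predT); last by move=> u _; exact: measurable_chamber.
under eq_bigr => u _ do rewrite -/(chamber u) chamber_open open_chamber_perm.
have [v ->] : exists v, lebesgue_row (open_chamber 1%g) = v%:E.
  exists (fine (lebesgue_row (open_chamber 1%g))); rewrite fineK//.
  rewrite ge0_fin_numE//; apply: (@le_lt_trans _ _ 1%E); last exact: ltry.
  rewrite -(lebesgue_row_cube R m); apply: le_measure; rewrite ?inE.
  - exact: measurable_open_chamber.
  - exact: measurable_cube.
  - by move=> y [].
rewrite sumEFin sumr_const card_Sn => -[h]; congr (_%:E).
have m0 : m`!%:R != 0 :> R by rewrite pnatr_eq0 -lt0n fact_gt0.
by apply: (mulfI m0); rewrite divff// mulr_natl.
Qed.

Definition desR y : {set 'I_m} :=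
  [set i : 'I_m | (0 < i)%N && (y 0 i < y 0 (pred_ord i))]%SET.

Lemma Des_std y : Des (std y) = desR y.
Proof.
apply/setP => i; rewrite mem_Des inE; case: ltnP => //= i0.
rewrite std_lt /before /= [(i < _)%N]ltnNge leq_pred/= andbF orbF//.
Qed.

Lemma lebesgue_row_desR (T : {set 'I_m}) :
  lebesgue_row [set y | cube y /\ desR y = T] =
  (#|[set w : 'S_m | Des w == T]%SET|%:R / m`!%:R)%:E.
Proof.
have -> : [set y | cube y /\ desR y = T] =
  [set y | cube y /\ [pred w | Des w == T] (std y)].
  by apply/seteqP; split=> y [cy /=]; rewrite Des_std => /eqP.
rewrite (@lebesgue_row_fibers _ _ _ [pred w | Des w == T]); last by move=> u _;
  exact: measurable_chamber.
under eq_bigr => u _ do rewrite -/(chamber u) lebesgue_row_chamber.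
rewrite sumEFin sumr_const; congr (_%:E).
rewrite mulr_natl; congr (_ *+ _); apply: eq_card => w; rewrite !inE//.
Qed.

End Standardization.

(** * Stanley's map between slabs of the cube and descent classes *)

Section Stanley.
Context (R : realType) (m : nat).
Implicit Types (x y : 'rV[R]_m) (i j : 'I_m) (T : {set 'I_m}).
Local Open Scope classical_set_scope.

Definition psum x (k : nat) : R := \sum_(j < m | (j < k)%N) x 0 j.

Definition count_below T (k : nat) : nat := (\sum_(j in T) (j < k))%N.

(** The places where the partial sums pass an integer. For x in the cube 0 is never one of them,
    just as 0 is never a descent. *)
Definition jumps x : {set 'I_m} :=
  [set i : 'I_m | Num.floor (psum x i.+1) != Num.floor (psum x i)]%SET.

Lemma psum0 x : psum x 0 = 0.
Proof. by rewrite /psum big_pred0. Qed.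

Lemma psumS x i : psum x i.+1 = psum x i + x 0 i.
Proof.
rewrite /psum (bigD1 i)//= addrC; congr (_ + _).
by apply: eq_bigl => j; rewrite ltnS ltn_neqAle andbC.
Qed.

Lemma psum_full x : psum x m = \sum_i x 0 i.
Proof. by apply: eq_bigl => j; rewrite ltn_ord. Qed.

Lemma count_below0 T : count_below T 0 = 0%N.
Proof. exact: big1. Qed.

Lemma count_belowS T i : count_below T i.+1 = (count_below T i + (i \in T))%N.
Proof.
have -> : (i \in T) = (\sum_(j in T) (j == i))%N :> nat.
  have [iT|iT] := boolP (i \in T).
    by rewrite (bigD1 i)//= eqxx big1// => j /andP[_ /negbTE ->].
  by rewrite big1// => j jT; case: eqP => // ji; rewrite -ji jT in iT.
rewrite -big_split/=; apply: eq_bigr => j _.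
by rewrite ltnS leq_eqVlt (inj_eq val_inj); case: (j =P i) => [->|_];
  rewrite ?ltnn ?addn0.
Qed.

Lemma count_below_full T : count_below T m = #|T|.
Proof. by rewrite -sum1_card; apply: eq_bigr => j _; rewrite ltn_ord. Qed.

(** Each step is at least 0 and less than 1, so it raises the floor by 0 or 1, and by 1 exactly at a
    jump. *)
Lemma floor_psum x k : cube x -> (k <= m)%N ->
  Num.floor (psum x k) = (count_below (jumps x) k)%:Z.
Proof.
move=> cx; elim: k => [|k IH] km; first by rewrite psum0 floor0 count_below0.
pose i := Ordinal km; have /andP[x0 x1] := cx i.
rewrite (count_belowS _ i) PoszD -(IH (ltnW km)) inE (psumS x i) /=.
set a := psum x k.
have /andP[a0 a1] := floor_itv a.
have [->|ne] := eqVneq (Num.floor (a + x 0 i)) (Num.floor a); first by rewrite addr0.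
apply: floor_def; rewrite -addrA rmorphD/=.
have h : (Num.floor a + 1)%:~R <= a + x 0 i.
  rewrite leNgt; apply/negP => h; move/eqP: ne; apply.
  by apply: floor_def; rewrite h andbT; lra.
by move: h a1; rewrite !rmorphD/=; lra.
Qed.

(** On the piece with jump set T the floors of the partial sums are the constants subtracted here,
    so taking fractional parts is the affine map given by [psum_mx] and this translation. *)
Definition shift_row T : 'rV[R]_m := \row_i - (count_below T i.+1)%:R.

Definition psum_mx : 'M[R]_m := \matrix_(j, i) (j <= i)%:R.

Lemma det_psum_mx : \det psum_mx = 1.
Proof.
rewrite -det_tr det_trig; last first.
  by apply/is_trig_mxP => i j ij; rewrite !mxE leqNgt ij.
by apply: big1 => i _; rewrite !mxE leqnn.
Qed.

Lemma psum_mxE x T i :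
  (x *m psum_mx + shift_row T) 0 i = psum x i.+1 - (count_below T i.+1)%:R.
Proof.
rewrite !mxE; congr (_ + _); rewrite /psum [RHS]big_mkcond.
by apply: eq_bigr => j _; rewrite mxE ltnS; case: leqP; rewrite ?mulr1 ?mulr0.
Qed.

Lemma pred_ordS i : (0 < i)%N -> (pred_ord i).+1 = i :> nat.
Proof. by move=> i0; rewrite /= prednK. Qed.

(* Stanley's map: for x in the cube, y is the sequence of fractional parts of
   the partial sums of x, and the i-th fractional part is smaller than the
   previous one exactly when the i-th partial sum passes an integer. *)
Lemma jumpsP x T :
  (cube x /\ jumps x = T) <->
  (cube (x *m psum_mx + shift_row T) /\ desR (x *m psum_mx + shift_row T) = T).
Proof.
set y := x *m psum_mx + shift_row T.
have yE i : y 0 i = psum x i.+1 - (count_below T i.+1)%:R by exact: psum_mxE.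
have dy i : (0 < i)%N -> y 0 i = y 0 (pred_ord i) + x 0 i - (i \in T)%:R.
  by move=> i0; rewrite !yE pred_ordS// psumS count_belowS natrD; lra.
split=> [[cx JT]|[cy DT]].
- have cy : cube y.
    move=> i; have := floor_itv (psum x i.+1).
    by rewrite (floor_psum cx (ltn_ord i)) JT yE rmorphD/= -pmulrn => /andP[h1 h2];
      apply/andP; split; lra.
  split=> //; apply/setP => i; rewrite inE; case: (posnP i) => [i0|i0].
    rewrite -JT inE (psumS x i) i0 psum0 add0r floor0.
    by rewrite floor_eq (cx i).
  have /andP[x0 x1] := cx i.
  rewrite (dy _ i0); case: (i \in T); first by rewrite -addrA gtrDl subr_lt0.
  by rewrite subr0 gtrDl ltNge x0.
(* Conversely, y in the cube forces the floors of the partial sums to be the counts. Then x i is the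
   difference of consecutive entries of y, plus 1 at a descent, and so lies in [0, 1). *)
- have fl k : (k <= m)%N -> Num.floor (psum x k) = (count_below T k)%:Z.
    case: k => [|k] km; first by rewrite psum0 floor0 count_below0.
    have /andP[y0 y1] := cy (Ordinal km); rewrite yE/= in y0 y1.
    by apply: floor_def; rewrite rmorphD/= -pmulrn; apply/andP; split; lra.
  split.
    move=> i; have /andP[y0 y1] := cy i; case: (posnP i) => [i0|i0].
      have iT : i \notin T by rewrite -DT inE i0.
      move: y0 y1; rewrite yE psumS count_belowS (negbTE iT) addn0 i0 psum0 count_below0
        subr0 add0r.
      by move=> -> ->.
    have /andP[p0 p1] := cy (pred_ord i).
    have := dy _ i0; have : (i \in T) =
      (y 0 i < y 0 (pred_ord i)) by rewrite -{1}DT inE i0.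
    by case: ltP => h -> /=; lra.
  apply/setP => i; rewrite inE (fl _ (ltn_ord i)) (fl _ (ltnW (ltn_ord i))) count_belowS.
  by case: (i \in T); rewrite ?addn0 ?eqxx// addn1 eqz_nat gtn_eqF.
Qed.

Lemma measurable_desR T : measurable [set y : 'rV[R]_m | cube y /\ desR y = T].
Proof.
have -> : [set y : 'rV[R]_m | cube y /\ desR y = T] = @cube R m `&`
    [set y | forall i, [set y | (i \in T) = (0 < i)%N && (y 0 i < y 0 (pred_ord i))] y].
  apply/seteqP; split=> y [cy h]; split=> //.
    by move=> i; rewrite /= -h inE.
  by apply/setP => i; rewrite inE -h.
apply: measurableI; first exact: measurable_cube.
apply: measurable_forall => i.
have mP : measurable [set y : 'rV[R]_m | (0 < i)%N && (y 0 i < y 0 (pred_ord i))].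
  apply: measurable_pred; apply: measurable_and => //.
  exact: (measurable_fun_ltr (measurable_coord _) (measurable_coord _)).
case: (i \in T); first by congr measurable: mP; apply/seteqP; split=> y /=;
  [move->|move=> <-].
move/measurableC: mP; congr measurable; apply/seteqP; split=> y /=.
  by move/negP/negbTE.
by move=> <-.
Qed.

Lemma measurable_jumps T : measurable [set x : 'rV[R]_m | cube x /\ jumps x = T].
Proof.
have -> : [set x : 'rV[R]_m | cube x /\ jumps x = T] =
    [set x | [set y | cube y /\ desR y = T] (x *m psum_mx + shift_row T)].
  by apply/seteqP; split=> x /jumpsP.
exact: (measurable_preimage_affine _ _ (measurable_desR T)).
Qed.

Lemma lebesgue_row_jumps T :
  lebesgue_row [set x : 'rV[R]_m | cube x /\ jumps x = T] =
  (#|[set w : 'S_m | Des w == T]%SET|%:R / m`!%:R)%:E.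
Proof.
rewrite -lebesgue_row_desR.
have uU : psum_mx \in unitmx by rewrite unitmxE det_psum_mx unitr1.
have := lebesgue_row_affine (shift_row T) uU (measurable_desR T).
rewrite det_psum_mx normr1 invr1 mul1e => <-; congr lebesgue_row.
by apply/seteqP; split=> x /jumpsP.
Qed.

(** A floor equal to 0 means no jump before k. With k = n - s this is the source of the lower end of
    the interval in the theorem. *)
Lemma psum_lt1 x k : cube x -> (k <= m)%N ->
  (psum x k < 1) = (jumps x \subset [set i : 'I_m | (k <= i)%N]%SET).
Proof.
move=> cx km; have fk := floor_psum cx km.
have c0 : (psum x k < 1) = (count_below (jumps x) k == 0%N).
  have /andP[f0 f1] := floor_itv (psum x k); rewrite fk rmorphD/= -pmulrn in f0 f1.
  apply/idP/eqP => [h|h]; last by move: f1; rewrite h add0r.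
  have : (count_below (jumps x) k)%:R < 1 :> R by lra.
  by rewrite ltrn1; case: count_below.
rewrite c0 sum_nat_eq0; apply/forall_inP/fintype.subsetP => h i /h.
  by rewrite inE eqb0 -leqNgt.
by rewrite inE eqb0 -leqNgt.
Qed.

(** The floor of the total sum is the number of jumps, so the slab prescribes the size of the jump
    set and the bound on the partial sum prescribes where it lies. The bound [u] becomes n - 2, the
    end of the range of indices. *)
Lemma half_open_volume (q k u : nat) : (k <= m)%N -> (forall i, (i <= u)%N) ->
  lebesgue_row [set x : 'rV[R]_m |
     cube x /\ (q%:R <= \sum_i x 0 i < q.+1%:R) && (psum x k < 1)] =
  ((\sum_(T : {set 'I_m} | (T \subset int_interval m k u) && (#|T| == q))
     #|[set w : 'S_m | Des w == T]%SET|%:R) / m`!%:R)%:E.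
Proof.
move=> km ub.
have -> : [set x : 'rV[R]_m |
     cube x /\ (q%:R <= \sum_i x 0 i < q.+1%:R) && (psum x k < 1)] =
   [set x | cube x /\ [pred T : {set 'I_m} | (T \subset int_interval m k u) &&
     (#|T| == q)] (jumps x)].
  have E x : cube x -> (q%:R <= \sum_i x 0 i < q.+1%:R) && (psum x k < 1) =
     (jumps x \subset int_interval m k u) && (#|jumps x| == q).
    move=> cx; rewrite andbC (psum_lt1 cx km); congr andb.
      by have -> : int_interval m k u =
        [set i : 'I_m | (k <= i)%N]%SET by apply/setP => i; rewrite !inE ub andbT.
    have := floor_psum cx (leqnn m); rewrite count_below_full psum_full => fE.
    have /andP[f0 f1] := floor_itv (\sum_i x 0 i); rewrite fE rmorphD/= -pmulrn in f0 f1.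
    apply/idP/eqP => [/andP[h1 h2]|<-]; last by rewrite f0 -natr1 f1.
    have : q%:R < #|jumps x|.+1%:R :> R by rewrite -natr1; lra.
    have : #|jumps x|%:R < q.+1%:R :> R by lra.
    rewrite !ltr_nat; lia.
  by apply/seteqP; split=> x [cx]; rewrite ?E//= => h; split=> //; rewrite E.
rewrite (@lebesgue_row_fibers _ _ _
  [pred T : {set 'I_m} | (T \subset int_interval m k u) && (#|T| == q)]);
  last by move=> T _; exact: measurable_jumps.
under eq_bigr => T _ do rewrite lebesgue_row_jumps.
by rewrite sumEFin mulr_suml.
Qed.

Lemma closed_volume (q k u : nat) : (k <= m)%N -> (forall i, (i <= u)%N) ->
  lebesgue_row [set x : 'rV[R]_m |
     (forall i, 0 <= x 0 i <= 1) /\ (q%:R <= \sum_i x 0 i <= q.+1%:R) && (psum x k < 1)] =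
  ((\sum_(T : {set 'I_m} | (T \subset int_interval m k u) && (#|T| == q))
     #|[set w : 'S_m | Des w == T]%SET|%:R) / m`!%:R)%:E.
Proof.
move=> km ub; rewrite -(half_open_volume q km ub).
set A := (X in lebesgue_row X = _); set B := (X in _ = lebesgue_row X).
(* The closed region exceeds the half-open one only where some coordinate is 1 or the sum attains
   its upper bound; [None] stands for the latter. *)
pose F (o : option 'I_m) := [set x : 'rV[R]_m |
  if o is Some i then x 0 i = 1 else \sum_i x 0 i = q.+1%:R].
have FE o : exists c : 'cV[R]_m, exists b, (c != 0 \/ F o = set0) /\
    F o = [set v | (v *m c) 0 0 = b].
  case: o => [i|].
    exists (delta_mx i 0), 1; split; last first.
      by apply/seteqP; split=> v /=; rewrite -colE mxE.
    by left; apply/eqP => /colP/(_ i)/eqP; rewrite !mxE !eqxx oner_eq0.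
  exists (const_mx 1), q.+1%:R; split; last first.
    have E (v : 'rV[R]_m) : (v *m const_mx 1 : 'rV_1) 0 0 = \sum_i v 0 i.
      by rewrite mxE; apply: eq_bigr => j _; rewrite mxE mulr1.
    by apply/seteqP; split=> v /=; rewrite E.
  (* In dimension 0 the normal vector vanishes, but the empty sum cannot equal q + 1. *)
  case: (posnP m) => m0; [right|left].
    apply/seteqP; split=> v //=; rewrite big1 => [/eqP|i];
      first by rewrite eq_sym pnatr_eq0.
    by exfalso; have := ltn_ord i; lia.
  by apply/eqP => /colP/(_ (Ordinal m0))/eqP; rewrite !mxE oner_eq0.
have mF o : measurable (F o).
  by have [c [b [_ ->]]] := FE o; exact: measurable_hyperplane.
have F0 o : lebesgue_row (F o) = 0%E.
  have [c [b [[c0|->] FoE]]] := FE o; last exact: measure0.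
  by rewrite FoE lebesgue_row_hyperplane.
have [mU U0] := @measure_exists0 _ _ R (@lebesgue_row R m) _ F mF F0.
have ms : measurable_fun setT (fun x : 'rV[R]_m => \sum_i x 0 i : measurableTypeR R).
  by apply: measurable_sum => i; exact: measurable_coord.
have mp : measurable_fun setT (fun x : 'rV[R]_m => psum x k : measurableTypeR R).
  by rewrite /psum; under eq_fun do rewrite -big_filter; apply: measurable_sum => i;
    exact: measurable_coord.
have mA : measurable A.
  apply: measurableI.
    apply: measurable_forall => i; apply: measurable_pred; apply: measurable_and.
      exact: (measurable_fun_ler _ (measurable_coord _)).
    exact: (measurable_fun_ler (measurable_coord _)).
  apply: measurable_pred; apply: measurable_and; first apply: measurable_and.
  - exact: (measurable_fun_ler _ ms).
  - exact: (measurable_fun_ler ms).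
  - exact: (measurable_fun_ltr mp).
have mB : measurable B.
  apply: measurableI; first exact: measurable_cube.
  apply: measurable_pred; apply: measurable_and; first apply: measurable_and.
  - exact: (measurable_fun_ler _ ms).
  - exact: (measurable_fun_ltr ms).
  - exact: (measurable_fun_ltr mp).
apply/eqP; rewrite eq_le; apply/andP; split; last first.
  apply: le_measure; rewrite ?inE// => x [cx /andP[/andP[h1 h2] h3]]; split.
    by move=> i; have /andP[-> /ltW] := cx i.
  by rewrite h1 (ltW h2).
rewrite -(measureU0 mB mU U0).
apply: le_measure; rewrite ?inE//; first exact: measurableU.
move=> x [cx /andP[/andP[h1 h2] h3]].
have [ [w Fw]|nF] := pselect (exists w, F w x); [by right; exists w|left].
split; last first.
  rewrite /= h1 h3 andbT lt_neqAle h2 andbT; apply/eqP => h.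
  by apply: nF; exists None.
move=> i; have /andP[-> h] := cx i; rewrite /= lt_neqAle h andbT; apply/eqP => h'.
by apply: nF; exists (Some i).
Qed.

End Stanley.

(** * Lattice frames *)

Section LatticeFrames.
Context (R : realType).
Local Open Scope classical_set_scope.

Lemma det_int d (G : 'M[R]_d) : (forall i j, G i j \is a Num.int) -> \det G \is a Num.int.
Proof.
move=> Gi; apply: rpred_sum => s _; apply: rpredM; first exact: rpred_sign.
by apply: rpred_prod => i _; exact: Gi.
Qed.

Lemma normr_int_unit (a b : R) : a \is a Num.int -> b \is a Num.int ->
  a * b = 1 -> `|a| = 1.
Proof.
move=> /intrP[i ->] /intrP[j ->]; rewrite -intrM => /eqP.
rewrite -[1]/(1%:~R) eqr_int => /eqP ij; rewrite -intr_norm; congr (_%:~R).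
have : (`|i| * `|j| = 1)%N by rewrite -abszM ij.
by move/eqP; rewrite muln_eq1 => /andP[/eqP i1 _]; rewrite -abszE i1.
Qed.

Lemma lattice_frame_inj n (L : set 'rV[R]_n) (c : frame R n) :
  lattice_frame L c -> row_free (tagged c).2.
Proof.
case: c => d [p B] [inj _ _] /=; rewrite -kermx_eq0; apply/rowV0P => v.
move=> /sub_kermxP vB; have := inj v 0; rewrite /frame_map/= vB mul0mx.
exact.
Qed.

(* The linear part of c is that of c0 up to a matrix G, recovered by composing
   with a right inverse of the linear part of c0. *)
Lemma lattice_frame_transition n (L : set 'rV[R]_n) (c c0 : frame R n) :
  lattice_frame L c -> lattice_frame L c0 ->
  exists (G : 'M[R]_(frame_dim c, frame_dim c0)) (q : 'rV[R]_(frame_dim c0)),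
    [/\ forall y, frame_map (y : 'rV_(frame_dim c)) = frame_map (c := c0) (y *m G + q),
        forall i j, G i j \is a Num.int & integer_points q].
Proof.
move=> fc f0; have /row_freeP[X BX] := lattice_frame_inj f0.
move: c c0 fc f0 X BX => [d [p B]] [e [p0 B0]] /= [_ rg im] [inj0 rg0 im0] X BX.
rewrite /frame_dim/=; rewrite /frame_map/= in rg im rg0 im0 inj0 *.
exists (B *m X), ((p - p0) *m X).
have E y : p + y *m B = p0 + (y *m (B *m X) + (p - p0) *m X) *m B0.
  have : L (p + y *m B) by rewrite -rg; exists y.
  rewrite -rg0 => -[x _ xE].
  have -> : y *m (B *m X) + (p - p0) *m X = x.
    rewrite mulmxA -mulmxDl addrA [y *m B + p]addrC -xE [p0 + _]addrC addrK.
    by rewrite -mulmxA BX mulmx1.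
  by rewrite xE.
have I y : integer_points y -> integer_points (y *m (B *m X) + (p - p0) *m X).
  move=> yi; have : (integer_points (n := n) `&` L) (p + y *m B) by rewrite -im; exists y.
  rewrite -im0 => -[x xi]; rewrite E => /inj0 <- //.
have i0 : integer_points (0 : 'rV[R]_d) by move=> j; rewrite mxE.
have qi : integer_points ((p - p0) *m X) by have := I _ i0; rewrite mul0mx add0r.
split=> // i j; have di : integer_points (delta_mx 0 i : 'rV[R]_d).
  by move=> k; rewrite mxE; case: (_ && _).
have := I _ di j; rewrite mxE -rowE mxE => h.
by have := rpredB h (qi j); rewrite addrK.
Qed.

(** The transitions in both directions are integral and mutually inverse. Hence the dimensions agree
    and the determinant is 1 or -1, so the affine change of variables preserves volume. *)
Lemma lattice_frame_volume n (L : set 'rV[R]_n) (c c0 : frame R n) (P : set 'rV[R]_n) :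
  lattice_frame L c -> lattice_frame L c0 ->
  measurable (frame_map (c := c0) @^-1` P) ->
  frame_dim c = frame_dim c0 /\
  lebesgue_row (frame_map (c := c) @^-1` P) = lebesgue_row (frame_map (c := c0) @^-1` P).
Proof.
move=> fc f0 mQ.
have [G [q [E Gi qi]]] := lattice_frame_transition fc f0.
have [H [q' [E' Hi _]]] := lattice_frame_transition f0 fc.
have GH : G *m H = 1%:M.
  apply/row_matrixP => i.
  have inj : injective (frame_map (c := c)) by case: fc.
  have h y : y = (y *m G + q) *m H + q' by apply: inj; rewrite -E' -E.
  have h0 := h 0; rewrite mul0mx add0r in h0.
  by rewrite !rowE mulmx1 [RHS]h mulmxDl -addrA -h0 addr0 mulmxA.
have HG : H *m G = 1%:M.
  apply/row_matrixP => i.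
  have inj : injective (frame_map (c := c0)) by case: f0.
  have h y : y = (y *m H + q') *m G + q by apply: inj; rewrite -E -E'.
  have h0 := h 0; rewrite mul0mx add0r in h0.
  by rewrite !rowE mulmx1 [RHS]h mulmxDl -addrA -h0 addr0 mulmxA.
have de : frame_dim c = frame_dim c0.
  have rf : row_free G by apply/row_freeP; exists H.
  have rl : row_full G by apply/row_fullP; exists H.
  by move: rf rl; rewrite /row_free /row_full => /eqP rd /eqP; exact: etrans (esym rd).
split=> //.
move: c c0 fc f0 mQ G q E Gi qi H q' E' Hi GH HG de => [d c] [e c0].
rewrite /frame_dim/= => fc f0 mQ G q E Gi qi H q' E' Hi GH HG de; subst e.
have dG : `|\det G| = 1.
  by apply: (@normr_int_unit _ (\det H)); rewrite ?det_int// -det_mulmx GH det1.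
have uG : G \in unitmx by have [] := mulmx1_unit GH.
have := lebesgue_row_affine q uG mQ; rewrite dG invr1 mul1e => <-.
by congr lebesgue_row; apply/seteqP; split=> y /=; rewrite E.
Qed.

Lemma normalized_volumeE n (P : set 'rV[R]_n) (c0 : frame R n) :
  lattice_frame (affine_hull P) c0 ->
  measurable (frame_map (c := c0) @^-1` P) ->
  normalized_volume P =
  ((frame_dim c0)`!%:R%:E * lebesgue_row (frame_map (c := c0) @^-1` P))%E.
Proof.
move=> f0 mQ; rewrite /normalized_volume.
set c := xget _ _.
have fc : lattice_frame (affine_hull P) c by apply: xgetPex; exists c0.
by have [dE ->] := lattice_frame_volume fc f0 mQ; rewrite dE.
Qed.

Definition perm_frame n (s : 'S_n) (c : frame R n) : frame R n :=
  existT _ (frame_dim c) ((tagged c).1 *m perm_mx s, (tagged c).2 *m perm_mx s).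

Lemma perm_frame_map n (s : 'S_n) (c : frame R n) x :
  frame_map (c := perm_frame s c) x = frame_map (c := c) x *m perm_mx s.
Proof. by rewrite /frame_map/= mulmxDl mulmxA. Qed.

Lemma mul_perm_mxE n (s : 'S_n) (x : 'rV[R]_n) i : (x *m perm_mx s) 0 i = x 0 (s^-1%g i).
Proof. by rewrite -[s]invgK -col_permE mxE invgK. Qed.

Lemma mul_perm_mxK n (s : 'S_n) (x : 'rV[R]_n) : x *m perm_mx s *m perm_mx s^-1 = x.
Proof. by apply/rowP => i; rewrite !mul_perm_mxE invgK permK. Qed.

Lemma perm_frame_lattice n (s : 'S_n) (L : set 'rV[R]_n) (c : frame R n) :
  (forall (u : 'S_n) x, L x -> L (x *m perm_mx u)) ->
  lattice_frame L c -> lattice_frame L (perm_frame s c).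
Proof.
move=> Lp [inj rg im].
have E : frame_map (c := perm_frame s c) = (mulmx^~ (perm_mx s)) \o frame_map (c := c).
  by apply/funext => x; rewrite perm_frame_map.
have intp (u : 'S_n) (x : 'rV[R]_n) : integer_points x -> integer_points (x *m perm_mx u).
  by move=> xi i; rewrite mul_perm_mxE.
have surj (A : set 'rV[R]_n) : (forall (u : 'S_n) x, A x -> A (x *m perm_mx u)) ->
    (mulmx^~ (perm_mx s)) @` A = A.
  move=> Ap; apply/seteqP; split=> [_ [x Ax <-]|x Ax]; first exact: Ap.
  by exists (x *m perm_mx s^-1); [exact: Ap|rewrite -{2}[s]invgK mul_perm_mxK].
split; rewrite E.
- apply: inj_comp => // x y /(congr1 (mulmx^~ (perm_mx s^-1))).
  by rewrite /= !mul_perm_mxK.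
- transitivity ((mulmx^~ (perm_mx s)) @` range (frame_map (c := c))).
    exact/esym/image_comp.
  by rewrite rg surj.
- transitivity ((mulmx^~ (perm_mx s)) @` (frame_map (c := c) @` @integer_points R _)).
    exact/esym/image_comp.
  rewrite im surj// => u x [xi Lx]; split; [exact: intp|exact: Lp].
Qed.

End LatticeFrames.

(** * The slice of fixed coordinate sum and its chart *)

Section Chart.
Context (R : realType) (m r : nat).
Local Open Scope classical_set_scope.

Definition sum_slice : set 'rV[R]_(m.+1) := [set x | \sum_i x 0 i = r%:R].

(* The chart of the slice that forgets the last coordinate. *)
Definition chart_base : 'rV[R]_(m.+1) := r%:R *: delta_mx 0 ord_max.
Definition chart_mx : 'M[R]_(m, m.+1) :=
  \matrix_(j, i) ((i == widen_ord (leqnSn m) j)%:R - (i == ord_max)%:R).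
Definition chart_frame : frame R m.+1 := existT _ m (chart_base, chart_mx).
Definition chart (x : 'rV[R]_m) : 'rV[R]_(m.+1) := chart_base + x *m chart_mx.

Lemma chart_widen x (j : 'I_m) : chart x 0 (widen_ord (leqnSn m) j) = x 0 j.
Proof.
have wm : widen_ord (leqnSn m) j == ord_max = false.
  by apply/negbTE; rewrite -val_eqE/= neq_ltn ltn_ord.
rewrite !mxE wm andbF mulr0 add0r (bigD1 j)//= big1 => [|k kj].
  by rewrite mxE eqxx wm subr0 mulr1 addr0.
rewrite mxE wm subr0 -val_eqE/= eq_sym; move: kj; rewrite -val_eqE/= => /negbTE ->.
by rewrite mulr0.
Qed.

Lemma chart_max x : chart x 0 ord_max = r%:R - \sum_j x 0 j.
Proof.
rewrite !mxE !eqxx/= mulr1 -sumrN; congr (_ + _); apply: eq_bigr => j _.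
have wm : ord_max == widen_ord (leqnSn m) j = false.
  by apply/negbTE; rewrite -val_eqE/= neq_ltn ltn_ord orbT.
by rewrite mxE wm eqxx sub0r mulrN1.
Qed.

Lemma chart_sum x : \sum_i chart x 0 i = r%:R.
Proof.
rewrite big_ord_recr/= chart_max.
by under eq_bigr do rewrite chart_widen; rewrite addrC subrK.
Qed.

Lemma chartK (v : 'rV[R]_(m.+1)) : sum_slice v ->
  chart (\row_j v 0 (widen_ord (leqnSn m) j)) = v.
Proof.
rewrite /sum_slice/= big_ord_recr/= => vr; apply/rowP => i.
have [im|im] := ltnP i m.
  have -> : i = widen_ord (leqnSn m) (Ordinal im) by apply: val_inj.
  by rewrite chart_widen mxE.
have -> : i = ord_max by apply: val_inj => /=; apply/eqP;
  rewrite eqn_leq im -ltnS ltn_ord.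
rewrite chart_max -vr [X in _ - X](eq_bigr (fun j => v 0 (widen_ord (leqnSn m) j))) =>
  [|j _].
  by rewrite addrAC subrr add0r.
by rewrite mxE.
Qed.

(** The forgotten coordinate is r minus the sum of the others, hence an integer as soon as they
    are. *)
Lemma chart_lattice : lattice_frame sum_slice chart_frame.
Proof.
have rg : range (frame_map (c := chart_frame)) = sum_slice.
  apply/seteqP; split=> [_ [x _ <-]|v Lv]; first exact: chart_sum.
  by exists (\row_j v 0 (widen_ord (leqnSn m) j)) => //; exact: chartK.
split=> //.
- move=> x y /= xy; apply/rowP => j; rewrite -(chart_widen x) -(chart_widen y).
  by rewrite /chart -[LHS]/(frame_map (c := chart_frame) x 0 _) xy.
- apply/seteqP; split=> [_ [x xi <-]|v [vi Lv]].
    split; last by rewrite -rg; exists x.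
    move=> i; have [im|im] := ltnP i m.
      have -> : i = widen_ord (leqnSn m) (Ordinal im) by apply: val_inj.
      by rewrite chart_widen.
    have -> : i = ord_max by apply: val_inj => /=; apply/eqP;
      rewrite eqn_leq im -ltnS ltn_ord.
    by rewrite chart_max; apply: rpredB; rewrite ?natr_int//; apply: rpred_sum.
  exists (\row_j v 0 (widen_ord (leqnSn m) j)); first by move=> j; rewrite mxE.
  exact: chartK.
Qed.

End Chart.

(** * The base polytope of a paving matroid *)

Section BasePolytope.
Context (R : realType) (n : nat) (M : matroid 'I_n).
Hypothesis pavingM : paving M.
Implicit Types (x y : 'rV[R]_n) (i j : 'I_n) (S H B : {set 'I_n}).
Local Notation r := (matroid_rank M).

Definition mass x S : R := \sum_(i in S) x 0 i.

(* The inequalities that cut out the base polytope of a paving matroid; those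
   of the hyperplanes of size r - 1 are redundant. *)
Definition in_cut_cube x : Prop :=
  [/\ forall i, 0 <= x 0 i <= 1, \sum_i x 0 i = r%:R
    & forall H, hyperplane M H -> mass x H <= r%:R - 1].

Lemma indicator_rowE B i : @indicator_row R n B 0 i = (i \in B)%:R.
Proof.
rewrite /indicator_row summxE; have [iB|iB] := boolP (i \in B).
  rewrite (bigD1 i)//= mxE !eqxx big1 ?addr0// => j /andP[_ ji].
  by rewrite mxE eqxx/= eq_sym (negbTE ji).
rewrite big1// => j jB; rewrite mxE eqxx/=.
by case: eqP => // ij; rewrite ij jB in iB.
Qed.

Lemma mass_indicator B S : mass (@indicator_row R n B) S = #|B :&: S|%:R.
Proof.
rewrite /mass; under eq_bigr do rewrite indicator_rowE.
rewrite -natr_sum -sum1_card [in RHS]big_mkcond [in LHS]big_mkcond/=; congr _%:R.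
by apply: eq_bigr => i _; rewrite inE andbC; case: (i \in S); case: (i \in B).
Qed.

Lemma mass_setT x : mass x [set: 'I_n] = \sum_i x 0 i.
Proof. by apply: eq_bigl => i; rewrite inE. Qed.

Lemma mass_sum k (a : 'I_k -> R) (v : 'I_k -> 'rV[R]_n) S :
  mass (\sum_l a l *: v l) S = \sum_l a l * mass (v l) S.
Proof.
rewrite /mass; under eq_bigr do rewrite summxE.
rewrite exchange_big/=; apply: eq_bigr => l _; rewrite mulr_sumr.
by apply: eq_bigr => i _; rewrite mxE.
Qed.

Lemma massE x S : mass x S = \sum_i (i \in S)%:R * x 0 i.
Proof.
rewrite /mass big_mkcond; apply: eq_bigr => i _.
by case: (i \in S); rewrite ?mul1r ?mul0r.
Qed.

Lemma mass1 x i : mass x [set i]%SET = x 0 i.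
Proof. by rewrite /mass big_set1. Qed.

Lemma base_polytope_cut x : base_polytope R M x -> in_cut_cube x.
Proof.
case=> k [v [a [vB a0 a1 ->]]].
have le S c : (forall l, mass (v l) S <= c) -> mass (\sum_l a l *: v l) S <= c.
  move=> h; rewrite mass_sum -[c]mul1r -a1 mulr_suml; apply: ler_sum => l _.
  by rewrite ler_wpM2l.
have ge S c : (forall l, c <= mass (v l) S) -> c <= mass (\sum_l a l *: v l) S.
  move=> h; rewrite mass_sum -[c]mul1r -a1 mulr_suml; apply: ler_sum => l _.
  by rewrite ler_wpM2l.
split.
- move=> i; rewrite -mass1; apply/andP; split.
    apply: ge => l; have [B _ <-] := vB l; rewrite mass_indicator; exact: ler0n.
  apply: le => l; have [B _ <-] := vB l; rewrite mass_indicator lern1.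
  by apply: (leq_trans (subset_leq_card (finset.subsetIr _ _))); rewrite cards1.
- have E l : mass (v l) [set: 'I_n] = r%:R.
    by have [B bB <-] := vB l; rewrite mass_indicator finset.setIT (basis_rank bB).
  apply/eqP; rewrite -mass_setT eq_le; apply/andP; split.
    by apply: le => l; rewrite E.
  by apply: ge => l; rewrite E.
- move=> H hH; apply: le => l; have [B bB <-] := vB l; rewrite mass_indicator.
  by have := basis_hyperplane bB hH; rewrite -(ler_nat R) -natr1; lra.
Qed.

(** Weights indexed by the bases themselves, rather than by a list of points as in [convex_hull],
    can be added when two combinations are mixed. *)
Definition basis_combination x : Prop := exists a : {set 'I_n} -> R,
  [/\ forall B, 0 <= a B, \sum_(B in bases M) a B = 1
    & x = \sum_(B in bases M) a B *: indicator_row R B].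

Lemma basis_combination_hull x : basis_combination x -> base_polytope R M x.
Proof.
case=> a [a0 a1 ->]; exists #|bases M|, (fun l => indicator_row R (enum_val l)),
  (a \o enum_val).
split.
- by move=> l; exists (enum_val l) => //; exact: enum_valP.
- by move=> l; exact: a0.
- by rewrite -a1 (big_enum_val a).
- by rewrite (big_enum_val (fun B => a B *: indicator_row R B)).
Qed.

Lemma basis_combination_convex x y (s t : R) : 0 < s -> 0 < t ->
  basis_combination x -> basis_combination y ->
  basis_combination ((s + t)^-1 *: (s *: x + t *: y)).
Proof.
move=> s0 t0 [a [a0 a1 ->]] [b [b0 b1 ->]].
have st0 : 0 < s + t by rewrite addr_gt0.
exists (fun B => (s + t)^-1 * (s * a B + t * b B)); split.
- by move=> B; rewrite mulr_ge0 ?invr_ge0 ?addr_ge0 ?mulr_ge0// ltW.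
- by rewrite -mulr_sumr big_split/= -!mulr_sumr a1 b1 !mulr1 mulVf// gt_eqF.
- rewrite !scaler_sumr -big_split scaler_sumr/=; apply: eq_bigr => B _.
  by rewrite !scalerA -scalerDl scalerA.
Qed.

Definition fractional x : {set 'I_n} := [set i | (0 < x 0 i) && (x 0 i < 1)]%SET.

(** Together with [fractional], this supplies the measure for the induction that replaces a theory
    of vertices. *)
Definition loose x : {set {set 'I_n}} :=
  [set H | hyperplane M H && (mass x H < r%:R - 1)]%SET.

Definition move_row x i j (t : R) : 'rV[R]_n :=
  x + t *: (delta_mx 0 i - delta_mx 0 j).

Lemma move_rowE x i j t k :
  move_row x i j t 0 k = x 0 k + t * ((k == i)%:R - (k == j)%:R).
Proof. by rewrite !mxE eqxx. Qed.

Lemma mass_move x i j t S :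
  mass (move_row x i j t) S = mass x S + t * ((i \in S)%:R - (j \in S)%:R).
Proof.
rewrite /mass; under eq_bigr do rewrite move_rowE.
rewrite big_split/= -mulr_sumr; congr (_ + t * _); rewrite sumrB.
have E k : \sum_(l in S) (l == k)%:R = (k \in S)%:R :> R.
  have [kS|kS] := boolP (k \in S).
    by rewrite (bigD1 k)//= eqxx big1 ?addr0// => l /andP[_ /negbTE ->].
  by rewrite big1// => l lS; case: eqP => // lk; rewrite -lk lS in kS.
by rewrite !E.
Qed.

Lemma seq_min (s : seq R) (a : R) :
  exists2 t, t \in a :: s & forall u, u \in a :: s -> t <= u.
Proof.
elim: s a => [|b s IH] a.
  by exists a; rewrite ?mem_head// => u; rewrite inE => /eqP ->.
have [t ts tmin] := IH b; have [at_|ta] := leP a t.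
  exists a; rewrite ?mem_head// => u; rewrite inE => /orP[/eqP ->//|/tmin].
  exact: le_trans.
exists t; first by rewrite inE ts orbT.
by move=> u; rewrite inE => /orP[/eqP ->|/tmin//]; exact: ltW.
Qed.

(** Going from x in the direction e_i - e_j up to the first new tight constraint loses no tight one,
    so [fractional] and [loose] can only shrink, and one of them does. *)
Lemma move_to_boundary x i j : in_cut_cube x -> i != j ->
  i \in fractional x -> j \in fractional x ->
  (forall H, hyperplane M H -> mass x H = r%:R - 1 -> (i \in H) = (j \in H)) ->
  exists2 t, 0 < t & in_cut_cube (move_row x i j t) /\
    (#|fractional (move_row x i j t)| + #|loose (move_row x i j t)| <
     #|fractional x| + #|loose x|)%N.
Proof.
move=> [x01 xr xH] ij iF jF tight.
have := iF; have := jF; rewrite !inE => /andP[j0 j1] /andP[i0 i1].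
pose Hs := [set H | [&& hyperplane M H, i \in H & j \notin H]]%SET.
(* Only three kinds of slack decrease along the move: that of x_i below 1, that of x_j above 0, and
   that of the hyperplanes containing i but not j. The step is the least of them. *)
have [t ts tmin] := seq_min (x 0 j :: [seq r%:R - 1 - mass x H | H <- enum Hs])
  (1 - x 0 i).
have t0 : 0 < t.
  move: ts; rewrite !inE => /or3P[/eqP->|/eqP->//|/mapP[H]]; first by rewrite subr_gt0.
  rewrite mem_enum inE => /and3P[hH iH jH] ->; rewrite subr_gt0 lt_neqAle xH// andbT.
  by apply/eqP => /(tight H hH); rewrite iH (negbTE jH).
have ti : t <= 1 - x 0 i by apply: tmin; rewrite inE eqxx.
have tj : t <= x 0 j by apply: tmin; rewrite !inE eqxx orbT.
have tH H : hyperplane M H -> i \in H -> j \notin H -> t <= r%:R - 1 - mass x H.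
  move=> hH iH jH; apply: tmin; rewrite !inE; apply/orP; right; apply/orP; right.
  by apply/mapP; exists H => //; rewrite mem_enum inE hH iH.
exists t => //; set y := move_row x i j t.
have yi : y 0 i = x 0 i + t by rewrite move_rowE eqxx (negbTE ij) subr0 mulr1.
have yj : y 0 j = x 0 j - t by rewrite move_rowE eqxx eq_sym (negbTE ij) sub0r mulrN1.
have yk k : k != i -> k != j -> y 0 k = x 0 k.
  by move=> ki kj; rewrite move_rowE (negbTE ki) (negbTE kj) subrr mulr0 addr0.
have cy : in_cut_cube y.
  split.
  - move=> k; have [->|ki] := eqVneq k i; first by rewrite yi; apply/andP; split; lra.
    have [->|kj] := eqVneq k j; first by rewrite yj; apply/andP; split; lra.
    by rewrite yk.
  - by rewrite -mass_setT mass_move !inE subrr mulr0 addr0 mass_setT.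
  - move=> H hH; rewrite mass_move; have := xH H hH.
    case: (boolP (i \in H)) => iH; case: (boolP (j \in H)) => jH /= hx.
    + by rewrite subrr mulr0 addr0.
    + by have := tH H hH iH jH; lra.
    + by lra.
    + by rewrite subrr mulr0 addr0.
split=> //.
have sF : (fractional y \subset fractional x).
  apply/fintype.subsetP => k; have [->//|ki] := eqVneq k i.
  have [->//|kj] := eqVneq k j; by rewrite !inE yk.
have sL : (loose y \subset loose x).
  apply/fintype.subsetP => H; rewrite !inE => /andP[hH]; rewrite hH mass_move/= => yH.
  rewrite lt_neqAle xH// andbT; apply/eqP => h; move: yH.
  by rewrite (tight H hH h) subrr mulr0 addr0 h ltxx.
have cF := subset_leq_card sF; have cL := subset_leq_card sL.
have prF k : k \in fractional x -> k \notin fractional y ->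
  (#|fractional y| < #|fractional x|)%N.
  by move=> kx ky; apply: proper_card; apply/properP; split=> //; exists k.
have prL H : H \in loose x -> H \notin loose y -> (#|loose y| < #|loose x|)%N.
  by move=> kx ky; apply: proper_card; apply/properP; split=> //; exists H.
move: ts; rewrite !inE => /or3P[/eqP tE|/eqP tE|/mapP[H]].
- have : i \notin fractional y by rewrite inE yi tE addrC subrK ltxx andbF.
  by move=> /(prF _ iF) h; rewrite -addSn leq_add.
- have : j \notin fractional y by rewrite inE yj tE subrr ltxx.
  by move=> /(prF _ jF) h; rewrite -addSn leq_add.
- rewrite mem_enum inE => /and3P[hH iH jH] tE.
  have Hy : H \notin loose y.
    by rewrite inE hH mass_move iH (negbTE jH) subr0 mulr1 tE addrC subrK ltxx.
  have Hx : H \in loose x by rewrite inE hH/=; lra.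
  by rewrite -addnS leq_add// (prL H).
Qed.

(** A sum with exactly one non-integral term is not an integer. *)
Lemma integral_mass_fractional x S (z : int) i : in_cut_cube x -> mass x S = z%:~R ->
  i \in S -> i \in fractional x -> exists j, [/\ j \in S, j \in fractional x & i != j].
Proof.
move=> [x01 _ _] xS iS iF.
have [//|nj] := pselect (exists j, [/\ j \in S, j \in fractional x & i != j]); exfalso.
have int01 j : j \in S -> j != i -> x 0 j \is a Num.int.
  move=> jS ji; have /andP[a b] := x01 j.
  have : j \notin fractional x by apply/negP => jF; apply: nj; exists j; rewrite eq_sym.
  by rewrite inE negb_and -!leNgt => /orP[h|h];
    [have -> : x 0 j = 0 by lra|have -> : x 0 j = 1 by lra].
have : x 0 i \is a Num.int.
  have -> : x 0 i = z%:~R - \sum_(j in S | j != i) x 0 j.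
    by rewrite -xS /mass (bigD1 i)//= addrK.
  by apply: rpredB; rewrite ?intr_int//; apply: rpred_sum => j /andP[]; exact: int01.
move: iF; rewrite inE => /andP[i0 i1] /intrP[w wE]; move: i0 i1; rewrite wE.
by rewrite ltr0z ltrz1; lia.
Qed.

Lemma massUI x H H' : mass x (H :|: H') + mass x (H :&: H') = mass x H + mass x H'.
Proof.
rewrite !massE -!big_split/=; apply: eq_bigr => k _; rewrite !inE.
by case: (k \in H); case: (k \in H'); rewrite ?mul0r ?mul1r ?addr0 ?add0r.
Qed.

Lemma mass_setC x S : mass x S + mass x (~: S) = \sum_i x 0 i.
Proof.
rewrite /mass [in RHS](bigID (mem S))/=; congr (_ + _).
by apply: eq_bigl => l; rewrite inE.
Qed.

Lemma mass_ge0 x S : (forall i, 0 <= x 0 i <= 1) -> 0 <= mass x S.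
Proof. by move=> x01; apply: sumr_ge0 => l _; case/andP: (x01 l). Qed.

Lemma mass_le_card x S : (forall i, 0 <= x 0 i <= 1) -> mass x S <= #|S|%:R.
Proof.
by move=> x01; rewrite -sumr_const; apply: ler_sum => l _; case/andP: (x01 l).
Qed.

Lemma hyperplane_meet_mass x H H' : (forall i, 0 <= x 0 i <= 1) ->
  hyperplane M H -> hyperplane M H' -> H != H' ->
  mass x (H :&: H') <= r%:R - 2%:R.
Proof.
move=> x01 hH hH' HH'; apply: le_trans (mass_le_card _ x01) _.
by have := hyperplane_meet pavingM hH hH' HH'; rewrite -(ler_nat R) -!natr1; lra.
Qed.

(** For distinct hyperplanes the masses of union and intersection would add up to more than 2r - 2,
    yet they are at most r and r - 2. *)
Lemma cut_disjoint x H H' : (forall i, 0 <= x 0 i <= 1) -> \sum_i x 0 i = r%:R ->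
  hyperplane M H -> hyperplane M H' ->
  r%:R - 1 < mass x H -> r%:R - 1 < mass x H' -> H = H'.
Proof.
move=> x01 xr hH hH' xH xH'; apply/eqP; apply: contraT => HH'.
have := hyperplane_meet_mass x01 hH hH' HH'; have := massUI x H H'.
have := mass_setC x (H :|: H'); have := mass_ge0 (~: (H :|: H')) x01; lra.
Qed.

(* The mass of the union is at most r, that of the intersection at most r - 2,
   and they add up to 2r - 2: so x = 0 outside the union and x = 1 on the
   intersection. *)
Lemma tight_symdiff x H H' i : in_cut_cube x -> hyperplane M H -> hyperplane M H' ->
  mass x H = r%:R - 1 -> mass x H' = r%:R - 1 -> H != H' ->
  i \in fractional x -> (i \in H) = (i \notin H').
Proof.
move=> [x01 xr _] hH hH' tH tH' HH'; rewrite inE => /andP[i0 i1].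
have UI := massUI x H H'.
have I2 := hyperplane_meet_mass x01 hH hH' HH'.
have UC := mass_setC x (H :|: H').
have rem S : i \in S -> mass x S = x 0 i + mass x (S :\ i).
  by move=> iS; rewrite /mass (big_setD1 i).
case: (boolP (i \in H)) => iH; case: (boolP (i \in H')) => iH' //=.
- have iI : i \in H :&: H' by rewrite inE iH.
  have := mass_le_card (H :&: H' :\ i) x01; have := rem _ iI.
  have := hyperplane_meet pavingM hH hH' HH'.
  rewrite (cardsD1 i) iI -(ler_nat R) -!natr1.
  by have := mass_ge0 (~: (H :|: H')) x01; lra.
- have iC : i \in ~: (H :|: H') by rewrite !inE (negbTE iH) (negbTE iH').
  have := mass_ge0 (~: (H :|: H') :\ i) x01; have := rem _ iC; lra.
Qed.

(* A tight hyperplane and its complement both have integral mass, so the one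
   containing i contains a second fractional coordinate j; by tight_symdiff the
   other tight hyperplanes cannot separate i from j either. *)
Lemma free_direction x i : in_cut_cube x -> i \in fractional x ->
  exists j, [/\ i != j, j \in fractional x &
    forall H, hyperplane M H -> mass x H = r%:R - 1 -> (i \in H) = (j \in H)].
Proof.
move=> cx iF; have [_ xr _] := cx.
have [[H0 [hH0 tH0]]|nt] :=
  pselect (exists H, hyperplane M H /\ mass x H = r%:R - 1); last first.
  have [||j [_ jF ij]] := @integral_mass_fractional x [set: 'I_n] r%:Z i cx _ _ iF.
  - by rewrite mass_setT xr.
  - by rewrite inE.
  by exists j; split=> // H hH tH; case: nt; exists H.
have key j : j \in fractional x -> (i \in H0) = (j \in H0) ->
    forall H, hyperplane M H -> mass x H = r%:R - 1 -> (i \in H) = (j \in H).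
  move=> jF ijH0 H hH tH; have [->//|HH0] := eqVneq H H0.
  by rewrite (tight_symdiff cx hH hH0 tH tH0 HH0 iF)
    (tight_symdiff cx hH hH0 tH tH0 HH0 jF) ijH0.
have [iH|iH] := boolP (i \in H0).
  have [|j [jH jF ij]] := @integral_mass_fractional x H0 (r%:Z - 1) i cx _ iH iF.
    by rewrite tH0 rmorphB.
  by exists j; split=> //; apply: key => //; rewrite iH jH.
have [||j [jH jF ij]] := @integral_mass_fractional x (~: H0) 1 i cx _ _ iF.
- by have := mass_setC x H0; rewrite xr tH0 mulr1z; lra.
- by rewrite inE.
by exists j; split=> //; apply: key => //; move: jH;
  rewrite inE (negbTE iH) => /negbTE ->.
Qed.

Lemma cut_cube_combination x : in_cut_cube x -> basis_combination x.
Proof.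
have [k] := ubnP (#|fractional x| + #|loose x|)%N.
elim: k x => // k IH x xk cx.
have [F0|[i iF]] := set_0Vmem (fractional x).
  have [x01 xr xH] := cx.
  have v01 j : x 0 j = 0 \/ x 0 j = 1.
    have /andP[a b] := x01 j; have : j \notin fractional x by rewrite F0 inE.
    by rewrite inE negb_and -!leNgt => /orP[h|h]; [left|right]; lra.
  pose B := [set j | x 0 j == 1]%SET.
  have xB : x = indicator_row R B.
    apply/rowP => j; rewrite indicator_rowE inE.
    by have [->|->] := v01 j; rewrite ?eqxx// eq_sym oner_eq0.
  have cB : #|B| = r.
    by apply/eqP; rewrite -(eqr_nat R) -xr -mass_setT xB mass_indicator finset.setIT.
  have bB : B \in bases M.
    apply: contraT => /(nonbasis_hyperplane pavingM cB)[H hH BH].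
    have := xH H hH; rewrite xB mass_indicator (finset.setIidPl BH) cB; lra.
  exists (fun B' => (B' == B)%:R); split.
  - by move=> B'; exact: ler0n.
  - by rewrite (bigD1 B)//= eqxx big1 ?addr0// => B' /andP[_ /negbTE ->].
  - rewrite (bigD1 B)//= eqxx scale1r big1 ?addr0 -?xB// => B' /andP[_ /negbTE ->].
    by rewrite scale0r.
have [j [ij jF tight]] := free_direction cx iF.
have [t t0 [cy ny]] := move_to_boundary cx ij iF jF tight.
have [||s s0 [cz nz]] := @move_to_boundary x j i cx _ jF iF.
- by rewrite eq_sym.
- by move=> H hH tH; rewrite tight.
(* The two moves are opposite, so x lies between their endpoints; each endpoint is weighted by the
   length of the other move. *)
have -> : x = (s + t)^-1 *: (s *: move_row x i j t + t *: move_row x j i s).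
  apply/rowP => l; rewrite !mxE.
  by field; rewrite gt_eqF ?addr_gt0.
apply: basis_combination_convex => //; apply: IH => //.
- by apply: leq_trans ny _; rewrite -ltnS.
- by apply: leq_trans nz _; rewrite -ltnS.
Qed.

Lemma base_polytopeP x : base_polytope R M x <-> in_cut_cube x.
Proof.
split; first exact: base_polytope_cut.
by move=> /cut_cube_combination/basis_combination_hull.
Qed.

End BasePolytope.

(** * The affine hull of the base polytope *)

Section AffineHull.
Context (R : realType).

Lemma affine_hull_shift n (S : set 'rV[R]_n) (u w w' : 'rV[R]_n) (c : R) :
  affine_hull S u -> S w -> S w' -> affine_hull S (u + c *: (w - w')).
Proof.
case=> k [v [a [vS a1 ->]]] Sw Sw'.
(* Two entries are prepended to the affine combination; their coefficients c and - c leave the total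
   equal to 1. *)
pose ext T (b b' : T) (f : 'I_k -> T) (l : 'I_k.+2) : T :=
  if unlift ord0 l is Some l' then
    if unlift ord0 l' is Some l'' then f l'' else b'
  else b.
have ext0 T b b' f : @ext T b b' f ord0 = b by rewrite /ext unlift_none.
have ext1 T b b' f : @ext T b b' f (lift ord0 ord0) =
  b' by rewrite /ext liftK unlift_none.
have ext2 T b b' f l : @ext T b b' f (lift ord0 (lift ord0 l)) =
  f l by rewrite /ext !liftK.
exists k.+2, (ext _ w w' v), (ext _ c (- c) a); split.
- move=> l; rewrite /ext; case: unliftP => // l' _.
  by case: unliftP.
- rewrite !big_ord_recl ext0 ext1 addrA subrr add0r -a1.
  by apply: eq_bigr => l _; rewrite ext2.
- rewrite !big_ord_recl !ext0 !ext1 addrC addrA scalerBr scaleNr.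
  by congr (_ + _); apply: eq_bigr => l _; rewrite !ext2.
Qed.

Lemma affine_hull_subset n (S : set 'rV[R]_n) x : S x -> affine_hull S x.
Proof.
move=> Sx; exists 1%N, (fun=> x), (fun=> 1).
by split; rewrite ?big_ord1 ?scale1r.
Qed.

Lemma base_polytope_basis n (M : matroid 'I_n) B : B \in bases M ->
  base_polytope R M (indicator_row R B).
Proof.
move=> bB; exists 1%N, (fun=> indicator_row R B), (fun=> 1).
by split; rewrite ?big_ord1 ?scale1r//; exists B.
Qed.

Lemma affine_hull_base_polytope m (M : matroid 'I_m.+1) :
  paving M -> matroid_connected M ->
  affine_hull (base_polytope R M) = @sum_slice R m (matroid_rank M).
Proof.
move=> pM cM; apply/seteqP; split=> [x [k [v [a [vP a1 ->]]]]|v vr].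
  rewrite /sum_slice/= -mass_setT mass_sum.
  rewrite (eq_bigr (fun l => a l * (matroid_rank M)%:R)) => [|l _].
    by rewrite -mulr_suml a1 mul1r.
  by rewrite mass_setT; have [_ ->] := base_polytope_cut (vP l).
have [B0 bB0] := basisP M.
have ex i : exists p : {set 'I_m.+1} * {set 'I_m.+1},
  [/\ p.1 \in bases M, p.2 \in bases M &
    indicator_row R p.1 - indicator_row R p.2 = delta_mx 0 i - delta_mx 0 ord0].
  have [->|i0] := eqVneq i ord0; first by exists (B0, B0); rewrite !subrr.
  have [B [bB iB jB bB']] := connected_exchange pM cM i0.
  exists (i |: (B :\ ord0), B); split=> //; apply/rowP => l.
  rewrite !mxE !indicator_rowE !inE eqxx/=.
  have [->|li] := eqVneq l i; first by rewrite (negbTE iB) (negbTE i0) !subr0.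
  have [->|l0] := eqVneq l ord0; first by rewrite jB.
  by rewrite /= subrr subr0.
have [f fP] := choice ex.
(* Both points have coordinate sum r, so the [c i] sum to 0 and every e_i may be replaced by e_i -
   e_0, a difference of two vertices. *)
pose c i := v 0 i - indicator_row R B0 0 i.
have sc : \sum_i c i = 0.
  rewrite sumrB vr -mass_setT mass_indicator finset.setIT (basis_rank bB0) subrr//.
have -> : v = indicator_row R B0 + \sum_(i <- enum 'I_m.+1)
    c i *: (indicator_row R (f i).1 - indicator_row R (f i).2).
  rewrite big_enum/= (eq_bigr (fun i => c i *: delta_mx 0 i - c i *: delta_mx 0 ord0)).
    rewrite sumrB -scaler_suml sc scale0r subr0.
    have -> : \sum_i c i *: delta_mx 0 i = v - indicator_row R B0.
      by rewrite [RHS]row_sum_delta; apply: eq_bigr => i _; rewrite !mxE.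
    by rewrite addrC subrK.
  by move=> i _; have [_ _ ->] := fP i; rewrite scalerBr.
elim: (enum _) => [|i s IH].
  rewrite big_nil addr0; exact/affine_hull_subset/base_polytope_basis.
rewrite big_cons addrCA addrC; apply: affine_hull_shift => //.
  by apply: base_polytope_basis; have [] := fP i.
by apply: base_polytope_basis; have [] := fP i.
Qed.

End AffineHull.

(** * Volumes of the hypersimplex, of the cuts and of the polytope *)

(** Sorting permutations by descent set puts the Eulerian number in the shape of [closed_volume] at
    k = 0. *)
Lemma eulerian_beta m q (u : nat) : (forall i : 'I_m, (i <= u)%N) ->
  eulerian m q = (\sum_(T : {set 'I_m} | (T \subset int_interval m 0 u) && (#|T| == q))
     #|[set w : 'S_m | Des w == T]%SET|)%N.
Proof.
move=> ub; rewrite /eulerian -sum1_card.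
rewrite (partition_big (@Des m) (fun T => (T \subset int_interval m 0 u) && (#|T| == q))).
  apply: eq_bigr => T /andP[_ /eqP Tq]; rewrite -sum1_card; apply: eq_bigl => w.
  by rewrite !inE; have [DT|] := eqVneq (Des w) T; rewrite ?andbF// DT Tq eqxx.
move=> w; rewrite inE => ->; rewrite andbT.
by apply/fintype.subsetP => i _; rewrite inE ub.
Qed.

(** List the complement of H, then H; [s j] is the entry at place j. *)
Lemma perm_initial_segment n (H : {set 'I_n}) :
  exists s : 'S_n, forall j, (s j \in H) = (n - #|H| <= j)%N.
Proof.
pose e := enum (~: H) ++ enum H.
have se : size e = n.
  by rewrite size_cat -!cardE addnC cardsC card_ord.
have ue : uniq e.
  rewrite cat_uniq !enum_uniq andbT/=; apply/hasPn => i.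
  by rewrite !mem_enum inE negbK.
have me i : i \in e by rewrite mem_cat !mem_enum inE orNb.
have ib i : (index i e < n)%N by rewrite -[X in (_ < X)%N]se index_mem.
have inj : injective (fun i => Ordinal (ib i)).
  by move=> i j [ij]; rewrite -(nth_index i (me i)) ij nth_index.
exists (perm inj)^-1%g => j; rewrite -{2}[j](permKV (perm inj)) permE/=.
move: ((perm inj)^-1%g j) => i; rewrite index_cat mem_enum inE -cardE.
have cC : #|~: H| = (n - #|H|)%N by rewrite cardsCs finset.setCK card_ord.
case: ifPn => iH.
  rewrite (negbTE iH); apply/esym/negbTE; rewrite -ltnNge -cC cardE index_mem.
  by rewrite mem_enum inE.
by rewrite cC leq_addr; apply/negbNE.
Qed.

(** * Volumes of the hypersimplex and of the pieces cut off *)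

Section CutVolumes.
Context (R : realType) (m r : nat).
Implicit Types (x y : 'rV[R]_m) (H : {set 'I_m.+1}).
Local Open Scope classical_set_scope.
Local Notation chart := (@chart R m r).

Definition in_slab : set 'rV[R]_m := [set x | forall i, 0 <= chart x 0 i <= 1].

Definition cut H : set 'rV[R]_m := [set x | in_slab x /\ r%:R - 1 < mass (chart x) H].

Lemma measurable_chart i :
  measurable_fun setT (fun x => chart x 0 i : measurableTypeR R).
Proof.
have := measurable_affine (chart_mx R m) (chart_base R m r)
  (@measurable_id _ 'rV[R]_m setT).
move=> /measurable_rowP/(_ i); apply: eq_measurable_fun => x _.
by rewrite /chart addrC.
Qed.

Lemma measurable_chart_mass H :
  measurable_fun setT (fun x => mass (chart x) H : measurableTypeR R).
Proof.
rewrite /mass; under eq_fun do rewrite -big_filter.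
by apply: measurable_sum => i; exact: measurable_chart.
Qed.

Lemma measurable_in_slab : measurable in_slab.
Proof.
apply: measurable_forall => i; apply: measurable_pred; apply: measurable_and.
  exact: (measurable_fun_ler _ (measurable_chart _)).
exact: (measurable_fun_ler (measurable_chart _)).
Qed.

Lemma measurable_cut H : measurable (cut H).
Proof.
apply: measurableI; first exact: measurable_in_slab.
by apply: measurable_pred; exact: (measurable_fun_ltr _ (measurable_chart_mass H)).
Qed.

Hypothesis r_gt0 : (0 < r)%N.

Lemma in_slabE x : in_slab x <->
  (forall i, 0 <= x 0 i <= 1) /\ (r.-1%:R <= \sum_i x 0 i <= r.-1.+1%:R).
Proof.
rewrite prednK//; have rE : r%:R = r.-1%:R + 1 :> R by rewrite natr1 prednK.
split=> [h|[x01 /andP[s0 s1]] i].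
  split; first by move=> i; have := h (widen_ord (leqnSn m) i); rewrite chart_widen.
  by have := h ord_max; rewrite chart_max => /andP[h0 h1]; apply/andP; split; lra.
have [im|im] := ltnP i m.
  have -> : i = widen_ord (leqnSn m) (Ordinal im) by apply: val_inj.
  by rewrite chart_widen.
have -> : i = ord_max by apply: val_inj => /=; apply/eqP;
  rewrite eqn_leq im -ltnS ltn_ord.
by rewrite chart_max; apply/andP; split; lra.
Qed.

(** All coordinates sum to r, so mass above r - 1 on the final segment means that the first k
    coordinates sum to less than 1. *)
Lemma mass_chart_final x k : (k <= m)%N ->
  mass (chart x) [set j : 'I_m.+1 | (k <= j)%N]%SET = r%:R - psum x k.
Proof.
move=> km; have := mass_setC (chart x) [set j : 'I_m.+1 | (k <= j)%N]%SET.
rewrite chart_sum => <-; rewrite [X in _ = _ + X - _](_ : _ = psum x k) ?addrK//.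
rewrite /mass /psum (eq_bigl (fun j : 'I_m.+1 => (j < k)%N)); last first.
  by move=> j; rewrite !inE -ltnNge.
rewrite big_mkcond big_ord_recr/= ltnNge km addr0 [RHS]big_mkcond.
by apply: eq_bigr => j _; rewrite chart_widen.
Qed.

(* Permuting the coordinates turns the chart into another lattice frame of the
   same slice, and volumes do not depend on the frame. *)
Lemma cut_perm H (s : 'S_m.+1) :
  lebesgue_row (cut H) = lebesgue_row (cut (s @^-1: H)).
Proof.
pose P := [set z : 'rV[R]_m.+1 | (forall i, 0 <= z 0 i <= 1) /\ r%:R - 1 < mass z H].
have f0 := @chart_lattice R m r.
have fs : lattice_frame (@sum_slice R m r) (perm_frame s (chart_frame R m r)).
  apply: perm_frame_lattice => // u z zr; rewrite /sum_slice/= -zr.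
  rewrite [RHS](reindex_inj (@perm_inj _ u^-1%g)); apply: eq_bigr => i _.
  exact: mul_perm_mxE.
have [_ vE] := lattice_frame_volume (P := P) fs f0 (measurable_cut H).
rewrite -[LHS]/(lebesgue_row (frame_map (c := chart_frame R m r) @^-1` P)) -vE.
have E y i : frame_map (c := perm_frame s (chart_frame R m r)) y 0 i =
  chart y 0 (s^-1%g i).
  by rewrite perm_frame_map mul_perm_mxE.
congr lebesgue_row; apply/seteqP.
have mE y : mass (frame_map (c := perm_frame s (chart_frame R m r)) y) H =
  mass (chart y) (s @^-1: H).
  rewrite /mass (reindex_inj (@perm_inj _ s)); apply: eq_big => i; first by rewrite inE.
  by move=> _; rewrite E permK.
split=> y [h1 h2]; split.
- by move=> i; have := h1 (s i); rewrite E permK.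
- by rewrite -mE.
- by move=> i; rewrite E; exact: h1.
- by rewrite mE.
Qed.

Lemma slab_volume (u : nat) : (forall i : 'I_m, (i <= u)%N) ->
  lebesgue_row in_slab = ((eulerian m r.-1)%:R / m`!%:R)%:E.
Proof.
move=> ub; have -> : (eulerian m r.-1)%:R = \sum_(T : {set 'I_m} |
    (T \subset int_interval m 0 u) && (#|T| == r.-1))
      #|[set w : 'S_m | Des w == T]%SET|%:R :> R.
  by rewrite (eulerian_beta _ ub) natr_sum.
rewrite -(closed_volume R _ (leq0n m) ub); congr lebesgue_row.
apply/seteqP; split=> x.
  by move=> /in_slabE[h1 h2]; split=> //; rewrite h2 psum0 ltr01.
by move=> [h1 /andP[h2 _]]; apply/in_slabE.
Qed.

Lemma cut_volume H (u : nat) : (forall i : 'I_m, (i <= u)%N) ->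
  lebesgue_row (cut H) =
  ((if (r <= #|H|)%N then
    \sum_(T : {set 'I_m} | (T \subset int_interval m (m.+1 - #|H|) u) && (#|T| == r.-1))
       #|[set w : 'S_m | Des w == T]%SET|%:R else 0) / m`!%:R)%:E.
Proof.
(* A set with fewer than r elements has mass at most r - 1, so its cut is empty. *)
move=> ub; case: ifPn => rH; last first.
  transitivity (lebesgue_row (set0 : set 'rV[R]_m)); last by rewrite mul0r measure0.
  congr lebesgue_row.
  apply/seteqP; split=> // x [h]; have := mass_le_card H h.
  by move: rH; rewrite -ltnNge -(ler_nat R) -natr1 => ? ?; rewrite ltNge => /negP[]; lra.
have km : (m.+1 - #|H| <= m)%N by rewrite leq_subLR; lia.
rewrite -(closed_volume R _ km ub).
have [s sE] := perm_initial_segment H; rewrite (cut_perm H s).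
have -> : s @^-1: H = [set j : 'I_m.+1 | (m.+1 - #|H| <= j)%N]%SET.
  by apply/setP => j; rewrite !inE sE.
congr lebesgue_row; apply/seteqP; split=> x.
  move=> [/in_slabE[h1 h2]]; rewrite mass_chart_final// => h3; split=> //.
  by rewrite h2/=; lra.
by move=> [h1 /andP[h2 h3]]; split; [apply/in_slabE|rewrite mass_chart_final//; lra].
Qed.

End CutVolumes.

(** * Subtracting the cuts from the hypersimplex *)

Section PolytopeVolume.
Context (R : realType) (m : nat) (M : matroid 'I_m.+1).
Hypothesis pavingM : paving M.
Hypothesis r_gt0 : (0 < matroid_rank M)%N.
Local Open Scope classical_set_scope.
Local Notation r := (matroid_rank M).

Let chart_polytope : set 'rV[R]_m :=
  frame_map (c := chart_frame R m r) @^-1` base_polytope R M.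

Let in_cut : set 'rV[R]_m :=
  [set x | in_slab r x /\ exists2 H, hyperplane M H & r%:R - 1 < mass (chart r x) H].

Lemma chart_polytopeE x : chart_polytope x <->
  in_slab r x /\ forall H, hyperplane M H -> mass (chart r x) H <= r%:R - 1.
Proof.
split; first by move=> /(base_polytopeP pavingM)[h1 _ h2].
move=> [h1 h2]; apply/(base_polytopeP pavingM); split=> //.
exact: chart_sum.
Qed.

(** On [in_cut] the pick is the only violated hyperplane, by [cut_disjoint]; the default is reached
    only outside it. *)
Let cutting x : {set 'I_m.+1} :=
  odflt finset.set0 [pick H | hyperplane M H && (r%:R - 1 < mass (@chart R m r x) H)].

Lemma cut_fiber H : hyperplane M H -> [set x | in_cut x /\ cutting x = H] = cut r H.
Proof.
move=> hH; apply/seteqP; split=> x; rewrite /cutting.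
  move=> [[xs [H' hH' xH']]]; case: pickP => /= [K /andP[_ xK] <-|/(_ H')];
    first by split.
  by rewrite hH' xH'.
move=> [xs xH]; split; first by split=> //; exists H.
case: pickP => /= [K /andP[hK xK]|/(_ H)]; last by rewrite hH xH.
by apply: (cut_disjoint pavingM xs _ hK hH xK xH); exact: chart_sum.
Qed.

Lemma in_cutE : in_cut = [set x | in_cut x /\ [pred H | hyperplane M H] (cutting x)].
Proof.
apply/seteqP; split=> x; last by case.
move=> xc; split=> //; case: xc => xs [H hH xH]; rewrite /cutting/=.
by case: pickP => /= [K /andP[]//|/(_ H)]; rewrite hH xH.
Qed.

Lemma measurable_in_cut : measurable in_cut.
Proof.
have -> : in_cut = [set x | exists H, (if hyperplane M H then cut r H else set0) x].
  apply/seteqP; split=> x.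
    by move=> [xs [H hH xH]]; exists H; rewrite hH.
  by move=> [H]; case: ifP => // hH [xs xH]; split=> //; exists H.
have -> : [set x | exists H, (if hyperplane M H then cut r H else set0) x] =
    \bigcup_(H in [set: {set 'I_m.+1}]) (if hyperplane M H then @cut R m r H else set0).
  by apply/seteqP; split=> x [H]; [exists H|exists H].
apply: fin_bigcup_measurable; first exact: finite_finset.
by move=> H _; case: ifP => // _; exact: measurable_cut.
Qed.

Lemma chart_polytope_setD : chart_polytope = in_slab r `\` in_cut.
Proof.
apply/seteqP; split=> x.
  move=> /chart_polytopeE[xs xH]; split=> // -[_ [H hH]].
  by rewrite ltNge xH.
move=> [xs nc]; apply/chart_polytopeE; split=> // H hH.
by rewrite leNgt; apply/negP => xH; apply: nc; split=> //; exists H.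
Qed.

Lemma measurable_chart_polytope : measurable chart_polytope.
Proof.
rewrite chart_polytope_setD; apply: measurableD; last exact: measurable_in_cut.
exact: measurable_in_slab.
Qed.

Lemma chart_polytope_volume (u : nat) : (forall i : 'I_m, (i <= u)%N) ->
  (m`!%:R%:E * lebesgue_row chart_polytope)%E =
  ((eulerian m r.-1)%:R - \sum_(H | hyperplane M H)
    if (r <= #|H|)%N then
    \sum_(T : {set 'I_m} | (T \subset int_interval m (m.+1 - #|H|) u) && (#|T| == r.-1))
       #|[set w : 'S_m | Des w == T]%SET|%:R else 0)%:E.
Proof.
move=> ub; have ms := @measurable_in_slab R m r.
have := slab_volume R r_gt0 ub.
have -> : in_slab r = chart_polytope `|` in_cut.
  rewrite chart_polytope_setD setUC setDUK// => x; exact: proj1.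
rewrite measureU//; last 3 first.
- exact: measurable_chart_polytope.
- exact: measurable_in_cut.
- by rewrite chart_polytope_setD setDKI.
rewrite [X in (_ + lebesgue_row X)%E]in_cutE lebesgue_row_fibers; last first.
  by move=> H hH; rewrite cut_fiber//; exact: measurable_cut.
under eq_bigr => H hH do rewrite (cut_fiber hH) (cut_volume R r_gt0 H ub).
rewrite sumEFin -mulr_suml => volE.
have m0 : m`!%:R != 0 :> R by rewrite pnatr_eq0 -lt0n fact_gt0.
set b := \sum_(H | _) _ in volE *.
have -> : lebesgue_row chart_polytope = ((eulerian m r.-1)%:R / m`!%:R - b / m`!%:R)%:E.
  by rewrite EFinB -volE addeK.
by rewrite -EFinM -mulrBl mulrC divfK.
Qed.

End PolytopeVolume.

Lemma base_polytope_rank0 (R : realType) n (M : matroid 'I_n) :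
  matroid_rank M = 0%N -> base_polytope R M = [set 0]%classic.
Proof.
move=> r0; apply/seteqP; split=> x.
  move=> /base_polytope_cut[x01 xr _]; apply/rowP => i; rewrite mxE.
  move: xr; rewrite r0 => /eqP; rewrite psumr_eq0; last by move=> j _; case/andP: (x01 j).
  by move=> /allP/(_ i); rewrite mem_index_enum => /(_ isT)/eqP.
move=> ->; have [B bB] := basisP M.
rewrite (_ : 0 = indicator_row R B); first exact: base_polytope_basis.
have /cards0_eq -> : #|B| = 0%N by rewrite (basis_rank bB).
by rewrite /indicator_row finset.big_set0.
Qed.

Lemma normalized_volume_point (R : realType) n :
  @normalized_volume R n [set 0]%classic = 1%E.
Proof.
pose c0 : frame R n := existT _ 0%N (0, 0).
have c0E x : frame_map (c := c0) x = 0 by rewrite /frame_map/= mulmx0 addr0.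
have aff : affine_hull [set 0]%classic = [set 0 : 'rV[R]_n]%classic.
  apply/seteqP; split=> x; last by move=> ->; exact: affine_hull_subset.
  by move=> [k [v [a [v0 _ ->]]]]; apply: big1 => i _; rewrite (v0 i) scaler0.
have pre : (frame_map (c := c0) @^-1` [set 0])%classic = setT.
  by apply/seteqP; split=> x //= _; rewrite c0E.
rewrite (@normalized_volumeE _ _ _ c0) ?pre//.
  by rewrite fact0 mul1e /lebesgue_row/= diracT.
rewrite aff; split.
- by move=> x y _; rewrite /frame_dim/= in x y *; rewrite [x]thinmx0 [y]thinmx0.
- apply/seteqP; split=> x; first by move=> [y _ <-]; rewrite c0E.
  by move=> ->; exists 0.
- apply/seteqP; split=> x.
    by move=> [y _ <-]; rewrite c0E; split=> // i; rewrite mxE.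
  by move=> [_ ->]; exists 0; rewrite ?c0E// => i; rewrite mxE.
Qed.

Theorem theorem7p4 (R : realType) (n r : nat) (M : matroid 'I_n)
    (rankM : matroid_rank M = r)
    (connectedM : matroid_connected M)
    (pavingM : paving M) :
  normalized_volume (base_polytope R M) =
  ((eulerian n.-1 r.-1)%:R
   - \sum_(r <= s < n.+1)
       #|hyperplanes_of_size M s|%:R *
       \sum_(T : {set 'I_n.-1} |
               (T \subset int_interval n.-1 (n - s) (n - 2)) && (#|T| == r.-1))
         (beta T)%:R)%:E.
Proof.
(* At rank 0 connectedness forces n to be at most 1, the polytope is the origin, and there are no
   hyperplanes. Since [r.-1] is then 0, the formula reads 1 = A(0, 0). *)
case: (posnP r) => [r0|r_gt0].
  have n1 : (n <= 1)%N.
    case: n M rankM connectedM pavingM => [|[|n]] // M rankM connectedM pavingM.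
    by have := connected_rank_gt0 pavingM connectedM (isT : ord0 != ord_max :> 'I_n.+2);
      rewrite rankM r0.
  rewrite base_polytope_rank0 ?rankM ?r0// normalized_volume_point.
  rewrite big1 => [|s _]; last first.
    rewrite (_ : hyperplanes_of_size M s = finset.set0) ?cards0 ?mul0r//.
    by apply/setP => H; rewrite !inE /hyperplane rankM r0 andbF.
  have -> : n.-1 = 0%N by case: n n1 {M rankM connectedM pavingM} => [|[]].
  rewrite subr0 /= /eulerian (_ : [set w : 'S_0 | _] = finset.setT).
    by rewrite cardsT card_Sn fact0.
  by apply/setP => w; rewrite !inE cards_eq0; apply/eqP/setP => -[].
case: n M rankM connectedM pavingM => [|m] M rankM connectedM pavingM.
  have [B bB] := basisP M; have := max_card (mem B).
  by rewrite (basis_rank bB) rankM card_ord leqn0 => /eqP r0; rewrite r0 in r_gt0.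
subst r; rewrite /=.
rewrite (@normalized_volumeE _ _ _ (chart_frame R m (matroid_rank M))); last 2 first.
- by rewrite affine_hull_base_polytope//; exact: chart_lattice.
- exact: measurable_chart_polytope.
have ub (i : 'I_m) : (i <= m.+1 - 2)%N by have := ltn_ord i; lia.
rewrite (chart_polytope_volume R pavingM r_gt0 ub); congr (_ - _)%:E.
set r := matroid_rank M; pose b s := \sum_(T : {set 'I_m} |
  (T \subset int_interval m (m.+1 - s) (m.+1 - 2)) && (#|T| == r.-1))
    #|[set w : 'S_m | Des w == T]%SET|%:R : R.
rewrite -[RHS]/(\sum_(r <= s < m.+2) #|hyperplanes_of_size M s|%:R * b s).
(* Each hyperplane is counted at s equal to its size; exchanging the sums leaves one term for each H
   with at least r elements. *)
have -> : \sum_(r <= s < m.+2) #|hyperplanes_of_size M s|%:R * b s =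
   \sum_(r <= s < m.+2) \sum_(H | hyperplane M H) (if s == #|H| then b s else 0).
  apply: eq_bigr => s _; rewrite -sumr_const mulr_suml big_mkcond [RHS]big_mkcond/=.
  by apply: eq_bigr => H _; rewrite inE eq_sym; case: hyperplane; case: eqP;
    rewrite ?mul1r.
rewrite exchange_big/=; apply: eq_bigr => H _.
rewrite -big_mkcond/= big_nat1_eq ltnS.
have -> : (#|H| <= m.+1)%N by have := max_card (mem H); rewrite card_ord.
by rewrite andbT.
Qed.
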